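(* Let $d\ge 1$ be a constant and $\epsilon\in(0,1)$. Every metric space $(X,\delta)$ of doubling dimension $d$ (with $X$ finite) has a $(1+\epsilon)$-spanner with lightness $\tilde{O}(\epsilon^{-(d+2)})$.
   Context: The doubling dimension of a metric space $(X,\delta)$ is the smallest $d$ such that every ball can be covered by at most $2^d$ balls of half its radius. A $(1+\epsilon)$-spanner of $(X,\delta)$ is a graph $S$ on vertex set $X$, each edge $\{x,y\}$ weighted $\delta(x,y)$, with $d_S(x,y)\le(1+\epsilon)\delta(x,y)$ for all $x,y\in X$; its lightness is its total edge weight divided by the weight of a minimum spanning tree of the complete graph on $X$ with weights $\delta$. $\tilde{O}$ suppresses a $\log(1/\epsilon)$ factor; the hidden constant may depend on $d$. *)

(* Defs.v *)
From HB Require Import structures.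
From mathcomp Require Export all_boot all_order all_algebra.
From mathcomp Require Export all_classical all_reals all_analysis.

Set Implicit Arguments.
Unset Strict Implicit.
Unset Printing Implicit Defensive.

Export Order.TTheory GRing.Theory Num.Theory.
Export numFieldNormedType.Exports.

Local Open Scope classical_set_scope.
Local Open Scope ring_scope.

#[short(type="finMetricType")]
HB.structure Definition FinMetric (R : numDomainType) :=
  { T of Metric R T & Finite T }.

(* [ball] is the library's open ball.  Since [X] is finite, each closed ball of
   radius r and its half-radius counterparts coincide with open balls of radius
   r + t and (r + t) / 2 for small t > 0 (and conversely with t < 0), so using
   closed balls would define the same dimension. *)
Definition doubling (R : realType) (X : finMetricType R) (d : R) : Prop :=
  forall (x : X) (r : R), 0 < r ->
    exists2 C : {set X}, #|C|%:R <= 2 `^ d &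
      ball x r `<=` \bigcup_(c in [set` C]) ball c (r / 2).

Definition doubling_dimension (R : realType) (X : finMetricType R) (d : R)
    : Prop :=
  doubling X d /\ forall d' : R, doubling X d' -> d <= d'.

Definition simple_graph (T : Type) (e : rel T) : Prop :=
  symmetric e /\ irreflexive e.

(* The double sum ranges over ordered pairs, hence counts every edge twice. *)
Definition weight (R : realType) (X : finMetricType R) (e : rel X) : R :=
  (\sum_(x : X) \sum_(y : X | e x y) mdist x y) / 2.

(* Total weight of the walk x :: p; [zip] pairs each vertex with the next. *)
Definition walk_weight (R : realType) (X : finMetricType R) (x : X)
    (p : seq X) : R :=
  \sum_(xy <- zip (x :: p) p) mdist xy.1 xy.2.

(* Equal to +oo when y is not reachable from x. *)
Definition graph_dist (R : realType) (X : finMetricType R) (e : rel X)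
    (x y : X) : \bar R :=
  ereal_inf [set (walk_weight x p)%:E | p in
              [set p : seq X | path e x p /\ last x p = y]].

Definition spanner (R : realType) (X : finMetricType R) (t : R) (e : rel X)
    : Prop :=
  simple_graph e /\
  forall x y : X, (graph_dist e x y <= (t * mdist x y)%:E)%E.

(* In a simple graph a duplicate-free cyclic sequence of length 2 merely runs
   back and forth along an edge; graph cycles are those of length at least 3. *)
Definition acyclic (T : eqType) (e : rel T) : Prop :=
  forall p : seq T, ucycle e p -> (size p <= 2)%N.

Definition spanning_tree (T : finType) (e : rel T) : Prop :=
  [/\ simple_graph e, (forall x y : T, connect e x y) & acyclic e].

Definition minimum_spanning_tree (R : realType) (X : finMetricType R)
    (e : rel X) : Prop :=
  spanning_tree e /\
  forall e' : rel X, spanning_tree e' -> weight e <= weight e'.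

(* All minimum spanning trees have the same weight, so the value does not
   depend on the choice of T. *)
Definition has_lightness (R : realType) (X : finMetricType R) (e : rel X)
    (l : R) : Prop :=
  exists2 T : rel X, minimum_spanning_tree T & l = weight e / weight T.

(* Main.v *)
Require Import Defs.
From mathcomp Require Import ring lra zify.
From mathcomp Require Import fintype finset.

Set Implicit Arguments.
Unset Strict Implicit.
Unset Printing Implicit Defensive.

Local Open Scope ring_scope.

(* Distances are split into O(log(1/eps)) classes of scales L, qL, q^2 L, ...
   with q of order 1/eps, and each class is treated on its own.  At each scale
   one keeps a connected subgraph F of the spanner built so far, initially the
   minimum spanning tree, whose vertices cover X up to O(eps L); a net of
   mesh of order eps L is chosen on F, and the net points at distance of order
   L that are not yet joined by a (1 + eps/2)-path are linked.  As every net
   point has O(eps^-d) links, it is enough to bound the number of net points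
   needed to meet all the links, and this number is charged to the decrease of
   the weight of F from one scale to the next.

   Root a spanning tree of F, let a be of order 10 L, and prune the branches
   shallower than a.  The weight lost pays for the net points on the pruned
   part and also for those within a of a branching vertex, because a leaf of
   the pruned tree has lost a branch of weight at least a/2, unless it hangs on
   an edge of length at least a/2.  Such an edge belongs to the minimum spanning
   tree, and its cost is charged to the sum over the edges of that tree of
   max(length - c L, 0).  Every remaining net point is in the middle of an
   unbranched path of length 2a.  Take a maximal family of links between such
   points with disjoint neighbourhoods.  Adding such a link to F closes a cycle,
   from which one may delete either the tree path between the end points of the
   link, longer than the link by eps L since the link was missing, or one half
   of the path around an end point.  In either case F loses at least eps L and
   the deletion pays for O(1/eps) net points, so a class costs O(eps^(-d-2))
   times the weight of the minimum spanning tree. *)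

(** * Sums, walks and nets *)

Section Sums.
Context {R : realType}.

(** The charging principle: net points that pay with pairwise disjoint sets of edges pay at most the
    total weight available. *)
Lemma disjoint_sum (I T : finType) (A : {set I}) (U : {set T})
    (S : I -> {set T}) (f : T -> R) :
  (forall z, 0 <= f z) ->
  (forall i, i \in A -> S i \subset U) ->
  (forall i j z, i \in A -> j \in A -> z \in S i -> z \in S j -> i = j) ->
  \sum_(i in A) \sum_(z in S i) f z <= \sum_(z in U) f z.
Proof.
move=> f0 SU SD.
rewrite (exchange_big_dep (mem U)) /=; last first.
  by move=> i z iA; apply/(fintype.subsetP (SU _ iA)).
apply: ler_sum => z _.
case: (pickP [pred i | (i \in A) && (z \in S i)]) => [i /= /andP[iA zi]|H].
  rewrite (big_pred1 i) // => j; apply/idP/eqP => [/andP[jA zj]|->].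
    exact: SD zi.
  by rewrite iA zi.
by rewrite big_pred0.
Qed.

(** Rounding the heights, measured from the lowest one, down to multiples of [s] is injective, and
    only [M] multiples are available. *)
Lemma card_sep_le (T : finType) (S : {set T}) (h : T -> R) (s : R) (M : nat) :
  0 < s -> (0 < M)%N ->
  (forall u v, u \in S -> v \in S -> u != v -> s <= `|h u - h v| < s * M%:R) ->
  (#|S| <= M)%N.
Proof.
move=> s0 M0 H; case: (set_0Vmem S) => [->|[x0 x0S]]; first by rewrite cards0.
have [u0 u0S umin] : exists2 u0, u0 \in S & forall u, u \in S -> h u0 <= h u.
  by case: (arg_minP h x0S) => u uS Hu; exists u.
pose g u := Num.truncn ((h u - h u0) / s).
have g0 u : u \in S -> 0 <= (h u - h u0) / s.
  by move=> uS; apply: divr_ge0 (ltW s0); rewrite subr_ge0 umin.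
have ginj : {in S &, injective g}.
  move=> u v uS vS guv; apply/eqP/negPn/negP => uv.
  have /andP[suv _] := H _ _ uS vS uv.
  have /andP[lu uu] := Num.Theory.truncn_itv (g0 _ uS).
  have /andP[lv uv'] := Num.Theory.truncn_itv (g0 _ vS).
  move: lu uu lv uv'; rewrite -/(g u) -/(g v) guv -natr1.
  set t := (g v)%:R; move=> lu uu lv uv'.
  have : `|(h u - h u0) / s - (h v - h u0) / s| < 1 by rewrite ltr_norml; lra.
  rewrite -mulrBl normrM normfV (gtr0_norm s0) ltr_pdivrMr // mul1r.
  rewrite (_ : _ - _ - _ = h u - h v); last by ring.
  by rewrite ltNge suv.
have gM u : u \in S -> (g u < M)%N.
  move=> uS; rewrite -(ltr_nat R).
  have /andP[lu uu] := Num.Theory.truncn_itv (g0 _ uS).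
  apply: le_lt_trans lu _; rewrite ltr_pdivrMr //.
  have [->|uu0] := eqVneq u u0; first by rewrite subrr mulr_gt0 ?ltr0n.
  have /andP[_] := H _ _ uS u0S uu0; rewrite mulrC; apply: le_lt_trans.
  exact: ler_norm.
case: M M0 H gM => // M _ H gM.
rewrite -[M.+1]card_ord.
have inj : {in S &, injective (fun u => inord (g u) : 'I_M.+1)}.
  move=> u v uS vS /(congr1 (@nat_of_ord _)).
  by rewrite !inordK ?gM //; apply: ginj.
by rewrite -(card_in_imset inj) max_card.
Qed.


Lemma card_cover_le (I T : finType) (A : {set I}) (U : {set T})
   (S : I -> {set T}) (n : nat) :
  (forall i, i \in A -> (#|S i| <= n)%N) ->
  (forall z, z \in U -> exists2 i, i \in A & z \in S i) ->
  (#|U| <= #|A| * n)%N.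
Proof.
move=> Sn US; apply: (@leq_trans (\sum_(i in A) #|S i|)%N); last first.
  by rewrite -sum_nat_const; apply: leq_sum.
under eq_bigr do rewrite -sum1_card.
rewrite (exchange_big_dep xpredT) //= -sum1_card big_mkcond /=.
apply: leq_sum => z _; case: ifP => // zU.
have [i iA zi] := US _ zU.
by rewrite (bigD1 i) ?iA //=.
Qed.

(** Follow a walk of [F] that starts outside [Z]: its steps can be copied in [F'] until a vertex of
    [Q] is met, and [Z] cannot be entered before that. In the surgery, [Z] is a removed region and
    [Q] its gates. *)
Lemma connect_retract (T : finType) (F F' : rel T) (Z Q : {set T}) :
  (forall x y : T, F x y -> x \notin Z -> x \in Q \/ (y \notin Z /\ connect F' x y)) ->
  forall x g : T, connect F x g -> x \notin Z -> g \in Z :|: Q ->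
  exists2 q, q \in Q & connect F' x q.
Proof.
move=> H x g /connectP[p]; elim: p x => [|y p IH] x /=.
  by move=> _ -> xZ; rewrite inE (negPf xZ) /= => xQ; exists x.
move=> /andP[Fxy pp] gE xZ gQ.
case: (H _ _ Fxy xZ) => [xQ|[yZ cxy]]; first by exists x.
have [q qQ cq] := IH _ pp gE yZ gQ.
by exists q => //; apply: connect_trans cq.
Qed.

End Sums.

Section Walks.
Context {R : realType} {X : finMetricType R}.
Implicit Types (x y z : X) (e : rel X) (p : seq X) (c : R).

Lemma walk_weight_nil x : walk_weight x [::] = 0.
Proof. by rewrite /walk_weight big_nil. Qed.

Lemma walk_weight_cons x y p :
  walk_weight x (y :: p) = mdist x y + walk_weight y p.
Proof. by rewrite /walk_weight /= big_cons. Qed.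

Lemma walk_weight_cat x p q :
  walk_weight x (p ++ q) = walk_weight x p + walk_weight (last x p) q.
Proof.
elim: p x => [|y p IH] x; first by rewrite walk_weight_nil add0r.
by rewrite cat_cons !walk_weight_cons IH addrA.
Qed.

(** A witnessed form of [graph_dist e x y <= c] that composes without extended reals. *)
Definition reach e x y c : Prop :=
  exists p, [/\ path e x p, last x p = y & walk_weight x p <= c].

Lemma reach_refl e x c : 0 <= c -> reach e x x c.
Proof. by move=> c0; exists [::]; rewrite walk_weight_nil. Qed.

Lemma reach_edge e x y c : e x y -> mdist x y <= c -> reach e x y c.
Proof.
move=> exy dc; exists [:: y]; split => //=; first by rewrite exy.
by rewrite walk_weight_cons walk_weight_nil addr0.
Qed.

Lemma reach_trans e y x z c1 c2 c :
  reach e x y c1 -> reach e y z c2 -> c1 + c2 <= c -> reach e x z c.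
Proof.
move=> [p [ep lp wp]] [q [eq lq wq]] cc; exists (p ++ q).
by rewrite cat_path last_cat walk_weight_cat lp ep; split => //; lra.
Qed.

Lemma reach_sub e e' x y c c' :
  (forall u v, e u v -> e' u v) -> c <= c' -> reach e x y c -> reach e' x y c'.
Proof.
move=> ee' cc [p [ep lp wp]]; exists p; split => //; last by lra.
exact: sub_path ep.
Qed.

Lemma reach_sym e x y c : symmetric e -> reach e x y c -> reach e y x c.
Proof.
move=> se [p]; elim: p x c => [|z p IH] x c /=.
  by move=> [_ -> wp]; apply: reach_refl; rewrite walk_weight_nil in wp.
move=> [/andP[exz ep] lp]; rewrite walk_weight_cons => wp.
have rz : reach e y z (walk_weight z p) by apply: IH; split.
have rx : reach e z x (mdist x z) by apply: reach_edge; rewrite 1?se // metric_sym.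
by apply: reach_trans rz rx _; lra.
Qed.

Lemma maximal_separated (S : {set X}) (s : R) : 0 < s ->
  exists N : {set X}, [/\ N \subset S,
    forall u v, u \in N -> v \in N -> u != v -> s <= mdist u v &
    forall x, x \in S -> exists2 y, y \in N & mdist x y < s].
Proof.
move=> s0.
pose P (N : {set X}) := (N \subset S) &&
  [forall u in N, forall v in N, (u != v) ==> (s <= mdist u v)].
have P0 : P finset.set0.
  by rewrite /P sub0set; apply/forall_inP => u; rewrite inE.
have [N /maxsetP[/andP[NS /forall_inP NP] Nmax] _] := maxset_exists P0.
exists N; split => // [u v uN vN uv|x xS].
  by have /forall_inP/(_ _ vN)/implyP/(_ uv) := NP _ uN.
case: (pickP [pred y in N | mdist x y < s]) => [y /andP[yN xy]|H].
  by exists y.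
have far y : y \in N -> s <= mdist x y.
  by move=> yN; have := H y; rewrite /= yN /= leNgt => ->.
(* Nothing in [N] is near [x], so [x |: N] is still separated; by maximality it equals [N], and [x]
   serves as its own net point. *)
exists x; rewrite ?mdistxx //.
rewrite -(Nmax (x |: N)) ?setU11 ?subsetUr //.
apply/andP; split; first by rewrite subUset sub1set xS.
apply/forall_inP => u /setU1P uN; apply/forall_inP => v /setU1P vN.
apply/implyP => uv; case: uN vN => [uE|uN] [vE|vN].
- by move: uv; rewrite uE vE eqxx.
- by rewrite uE far.
- by rewrite vE metric_sym far.
- by have /forall_inP/(_ _ vN)/implyP/(_ uv) := NP _ uN.
Qed.

Lemma weightE e : weight e = (\sum_(p : X * X | e p.1 p.2) mdist p.1 p.2) / 2.
Proof. by rewrite /weight pair_big_dep. Qed.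

(** The division by 2 in [weight] makes it enough to list every edge in one orientation. *)
Lemma weight_le_directed (e D : rel X) :
  (forall x y, e x y -> D x y || D y x) ->
  weight e <= \sum_(p : X * X | D p.1 p.2) mdist p.1 p.2.
Proof.
move=> eD; rewrite weightE ler_pdivrMr // mulr_natr mulr2n.
have E : \sum_(p : X * X | D p.1 p.2) mdist p.1 p.2 =
         \sum_(p : X * X | D p.2 p.1) mdist p.1 p.2.
  rewrite (reindex_inj (h := fun p : X * X => (p.2, p.1))) /=.
    by under eq_bigr do rewrite metric_sym.
  by move=> [a b] [a' b'] [-> ->].
rewrite {2}E big_mkcond [X in X + _]big_mkcond [X in _ + X]big_mkcond /=.
rewrite -big_split /=; apply: ler_sum => -[x y] _ /=.
have d0 := mdist_ge0 x y; have := eD x y.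
by case: (e x y); case: (D x y); case: (D y x) => //=; try lra; move=> /(_ isT).
Qed.

Lemma weight_ge0 e : 0 <= weight e.
Proof.
rewrite weightE; apply: divr_ge0 => //.
by apply: sumr_ge0 => p _; apply: mdist_ge0.
Qed.

Lemma weight_subadd (e e1 e2 : rel X) :
  (forall x y, e x y -> e1 x y || e2 x y) -> weight e <= weight e1 + weight e2.
Proof.
move=> H; rewrite !weightE -mulrDl ler_pM2r ?invr_gt0 //.
rewrite big_mkcond [X in X + _]big_mkcond [X in _ + X]big_mkcond /=.
rewrite -big_split /=; apply: ler_sum => -[x y] _ /=.
have d0 := mdist_ge0 x y; have := H x y.
by case: (e x y); case: (e1 x y); case: (e2 x y) => //=; try lra; move=> /(_ isT).
Qed.

(** Each edge from [x] to [par x] occupies two ordered pairs; as [par] has no 2-cycle on [U],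
    distinct vertices occupy distinct pairs. *)
Lemma weight_ge_parents (F : rel X) (U : {set X}) (par : X -> X) :
  symmetric F -> (forall x, x \in U -> F x (par x)) ->
  (forall x, x \in U -> par (par x) != x) ->
  \sum_(x in U) mdist x (par x) <= weight F.
Proof.
move=> sF FU pp; rewrite weightE ler_pdivlMr // mulr_suml.
pose S x : {set X * X} := [set (x, par x); (par x, x)].
have px x : x \in U -> x != par x.
  move=> xU; apply/eqP => xE; have := pp _ xU; by rewrite -xE -xE eqxx.
have := @disjoint_sum R _ _ U [set p : X * X | F p.1 p.2] S
  (fun p : X * X => mdist p.1 p.2).
rewrite [X in _ -> _ -> _ -> _ <= X](eq_bigl (fun p : X * X => F p.1 p.2)); last first.
  by move=> ?; rewrite inE.
move=> H; apply: le_trans (H _ _ _) => {H} [|?|x xU|x y [p1 p2] xU yU].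
- apply: ler_sum => x xU; rewrite /S big_setU1 /=; last first.
    by rewrite inE xpair_eqE negb_and px.
  by rewrite big_set1 /= (metric_sym (par x)) -mulr2n mulr_natr.
- exact: mdist_ge0.
- by apply/fintype.subsetP => -[? ?] /set2P[] [-> ->]; rewrite inE /= ?FU // sF FU.
- move=> /set2P[] [-> ->] /set2P[] [] // ex ey.
  + by have := pp _ xU; rewrite ey -ex eqxx.
  + by have := pp _ xU; rewrite ex ey eqxx.
Qed.

End Walks.

(** * Rooted trees *)

Section RootedTree.
Context {R : realType} {X : finMetricType R}.
Variables (par : X -> X) (h : X -> R) (r : X).
Hypothesis par_root : par r = r.
Hypothesis heightE : forall x, h x = h (par x) + mdist x (par x).
Implicit Types (x y z u v m b : X).

Definition anc z u := fconnect par u z.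

Lemma anc_refl x : anc x x. Proof. exact: connect0. Qed.

Lemma anc_trans y x z : anc x y -> anc y z -> anc x z.
Proof. by move=> xy yz; apply: connect_trans yz xy. Qed.

Lemma anc_par x : anc (par x) x. Proof. exact: fconnect1. Qed.

Lemma anc_parW z u : anc z (par u) -> anc z u.
Proof. by move=> H; apply: anc_trans H (anc_par u). Qed.

Lemma anc_step z u : anc z u -> z = u \/ anc z (par u).
Proof.
move=> zu; rewrite -(iter_findex zu); case: (findex _ _ _) => [|n]; first by left.
by right; rewrite iterSr; apply: fconnect_iter.
Qed.

Lemma anc_ind z (P : X -> Prop) :
  P z -> (forall u, anc z (par u) -> par u != u -> P (par u) -> P u) ->
  forall u, anc z u -> P u.
Proof.
move=> Pz Pu u zu.
have [n] : exists n, iter n par u = z by exists (findex par u z); exact: iter_findex.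
elim: n u {zu} => [|n IH] u; first by move=> /= ->.
rewrite iterSr => H; case: (eqVneq (par u) u) => [E|E].
  by apply: IH; rewrite E in H.
by apply: Pu => //; [rewrite -H; apply: fconnect_iter | apply: IH].
Qed.

(** This strict decrease, due to the positive distance of distinct points, makes [anc]
    antisymmetric. *)
Lemma height_par x : par x != x -> h (par x) < h x.
Proof. by move=> E; rewrite (heightE x) ltrDl mdist_gt0 eq_sym. Qed.

Lemma anc_height z u : anc z u -> h z <= h u.
Proof.
by move: u; apply: anc_ind => // u _ E; have := height_par E; lra.
Qed.

Lemma anc_height_lt z u : anc z u -> z != u -> h z < h u.
Proof.
move: u; apply: anc_ind => [|u zu E _ _]; first by rewrite eqxx.
by have := anc_height zu; have := height_par E; lra.
Qed.

Lemma anc_anti z u : anc z u -> anc u z -> z = u.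
Proof.
move=> zu uz; apply/eqP/negPn/negP => E.
have := anc_height_lt zu E; have := anc_height uz; lra.
Qed.

Lemma anc_chain z z' u : anc z u -> anc z' u -> anc z z' \/ anc z' z.
Proof.
move=> zu z'u; move: u zu z'u; apply: anc_ind => [|u zu _ IH]; first by right.
by move=> /anc_step[->|/IH //]; left; apply: anc_parW.
Qed.

Lemma anc_chain_lt z z' u : anc z u -> anc z' u -> h z < h z' -> anc z z'.
Proof.
move=> zu z'u lt; case: (anc_chain zu z'u) => // /anc_height; lra.
Qed.

Lemma anc_dist z u : anc z u -> mdist u z <= h u - h z.
Proof.
move: u; apply: anc_ind => [|u _ _ IH]; first by rewrite mdistxx subrr.
by have := metric_triangle u (par u) z; rewrite (heightE u); lra.
Qed.

Lemma anc_child z u : anc z u -> z != u ->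
  exists y, [/\ anc y u, par y = z & y != z].
Proof.
move: u; apply: anc_ind => [|u zu pu IH]; first by rewrite eqxx.
move=> zNu; have [E|E] := eqVneq z (par u).
  by exists u; split; rewrite ?anc_refl // eq_sym.
by have [y [yu py yz]] := IH E; exists y; split => //; apply: anc_parW.
Qed.

Lemma anc_root z : anc z r -> z = r.
Proof. by move=> H; rewrite -(iter_findex H) iter_fix. Qed.

Lemma anc_in_tree z u : anc z u -> anc r u -> anc r z.
Proof.
move=> zu ru; case: (anc_chain zu ru) => // /anc_root ->; exact: anc_refl.
Qed.

(* A tree edge is represented by its lower end point, so this is the set of
   edges of the path from u up to z. *)
Definition seg z u := [set y | [&& anc z y, anc y u & y != z]].

Lemma segxx u : seg u u = set0.
Proof.
apply/setP => y; rewrite !inE; apply/negP => /and3P[uy yu].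
by rewrite (anc_anti yu uy) eqxx.
Qed.

Lemma seg_par z u : anc z (par u) -> par u != u -> seg z u = u |: seg z (par u).
Proof.
move=> zu pu; apply/setP => y; rewrite !inE.
apply/and3P/orP => [[zy yu yz]|[/eqP ->|/and3P[zy yu yz]]].
- by have [->|->] := anc_step yu; [left; rewrite eqxx|right; rewrite zy].
- split; [exact: anc_parW|exact: anc_refl|].
  apply/eqP => E; rewrite -E in zu.
  by have := anc_height zu; have := height_par pu; lra.
- by split => //; apply: anc_parW.
Qed.

Lemma seg_sum z u : anc z u -> \sum_(y in seg z u) mdist y (par y) = h u - h z.
Proof.
move: u; apply: anc_ind => [|u zu pu IH]; first by rewrite segxx big_set0 subrr.
rewrite seg_par // big_setU1 /=; first by rewrite IH (heightE u); lra.
rewrite !inE; apply/negP => /and3P[_ /anc_height H _].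
by have := height_par pu; lra.
Qed.

Lemma seg_reach (G : rel X) z u :
  anc z u -> (forall y, y \in seg z u -> G y (par y)) -> reach G u z (h u - h z).
Proof.
move: u; apply: anc_ind => [|u zu pu IH] HG.
  by apply: reach_refl; rewrite subrr.
have S := seg_par zu pu.
apply: (@reach_trans _ _ G (par u) u z (mdist u (par u)) (h (par u) - h z)).
- by apply: reach_edge => //; apply: HG; rewrite S setU11.
- by apply: IH => y yS; apply: HG; rewrite S setU1r.
- by rewrite (heightE u); lra.
Qed.

Lemma reach_connect (G : rel X) x y c : reach G x y c -> connect G x y.
Proof. by move=> [p [pp <- _]]; apply/connectP; exists p. Qed.

(** Take the lowest ancestor at least [t] above [u]: its path to [u] weighs at least [t], while
    every vertex strictly below it on that path is still closer than [t]. *)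
Lemma first_above u (t : R) : 0 < t -> anc r u -> t <= h u - h r ->
  exists z, [/\ anc z u, t <= h u - h z & forall y, y \in seg z u -> h u - h y < t].
Proof.
move=> t0 ru tr.
have P0 : [pred z | anc z u && (t <= h u - h z)] r by rewrite /= ru.
case: (arg_maxP h P0) => z /= /andP[zu tz] zmax; exists z; split => // y.
rewrite inE => /and3P[zy yu yz]; rewrite ltNge; apply/negP => ty.
have := zmax y; rewrite /= yu ty => /(_ isT).
by rewrite leNgt anc_height_lt // eq_sym.
Qed.

(** * Children and branching vertices of a subtree *)

Section Subtree.
Variable W : {set X}.
Hypothesis rootW : r \in W.
Hypothesis parW : forall x, x \in W -> par x \in W.
Hypothesis treeW : forall x, x \in W -> anc r x.

(** Since [par r = r], the root has to be kept from being its own child. *)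
Definition kids x := [set y in W | (y != r) && (par y == x)].

Lemma anc_subtree z u : anc z u -> u \in W -> z \in W.
Proof.
by move: u; apply: anc_ind => // u _ _ IH uW; apply: IH; apply: parW.
Qed.

Lemma par_neq x : x \in W -> x != r -> par x != x.
Proof.
move=> xW; apply: contraNneq => E; have := treeW xW => H.
by rewrite -(iter_findex H) iter_fix.
Qed.

Lemma kids_toward z u : anc z u -> z != u -> u \in W ->
  exists2 y, y \in kids z & anc y u.
Proof.
move=> zu zNu uW; have [y [yu py yz]] := anc_child zu zNu; exists y => //.
rewrite inE (anc_subtree yu uW) py eqxx andbT /=.
by apply: contraNneq yz => E; rewrite -py E par_root.
Qed.

Lemma unary_kids_eq m y y' :
  #|kids m| = 1%N -> y \in kids m -> y' \in kids m -> y = y'.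
Proof.
by move=> /eqP/cards1P[k ->] /set1P -> /set1P ->.
Qed.

(** If the lowest common ancestor of [y] and [y'] differed from both, its only child would be a
    lower common ancestor. *)
Lemma unary_comparable x y y' : y \in W -> y' \in W -> anc x y -> anc x y' ->
  (forall m, anc x m -> anc m y -> m != y -> #|kids m| = 1%N) ->
  anc y y' \/ anc y' y.
Proof.
move=> yW y'W xy xy' H.
have P0 : [pred m | anc m y && anc m y'] x by rewrite /= xy.
case: (arg_maxP h P0) => m /= /andP[my my'] mmax.
have [E|mNy] := eqVneq m y; first by left; rewrite -E.
have [E|mNy'] := eqVneq m y'; first by right; rewrite -E.
have [k km ky] := kids_toward my mNy yW.
have [k' km' ky'] := kids_toward my' mNy' y'W.
have xm : anc x m.
  case: (anc_chain xy my) => // mx.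
  suff -> : m = x by apply: anc_refl.
  have := mmax x; rewrite /= xy xy' => /(_ isT) hx.
  apply/eqP/negPn/negP => E; have := anc_height_lt mx E.
  by rewrite ltNge hx.
have E : k = k' by apply: unary_kids_eq km km'; apply: H.
have := mmax k; rewrite /= ky E ky' => /(_ isT) hk.
move: km'; rewrite inE => /and3P[kW kr /eqP pk].
by have := height_par (par_neq kW kr); rewrite pk ltNge hk.
Qed.

Lemma sum_card_kids : (\sum_(x in W) #|kids x|)%N = #|W|.-1.
Proof.
rewrite (cardsD1 r W) rootW /= -sum1_card.
under eq_bigr do rewrite -sum1_card.
rewrite (exchange_big_dep (mem (W :\ r))) /=; last first.
  by move=> x y xW; rewrite !inE => /and3P[-> ->].
apply: eq_bigr => y; rewrite !inE => /andP[yr yW].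
rewrite (big_pred1 (par y)) // => x; rewrite !inE yW yr /= eq_sym.
by case: eqP => [->|]; rewrite ?andbF ?andbT ?parW.
Qed.

(** The numbers of children add up to [#|W| - 1], so the surplus children of the branching vertices
    are compensated by leaves: there are fewer branching vertices than leaves. *)
Lemma card_branching :
  (#|[set x in W | #|kids x| != 1%N]| < 2 * #|[set x in W | #|kids x| == 0%N]|)%N.
Proof.
have H : (\sum_(x in W) (1 + (1 < #|kids x|)%N) <=
          \sum_(x in W) (#|kids x| + (#|kids x| == 0%N)))%N.
  by apply: leq_sum => x _; case: #|kids x| => [|[|n]].
rewrite !big_split /= sum_card_kids sum1_card in H.
have W0 : (0 < #|W|)%N by apply/card_gt0P; exists r.
have c0 : (\sum_(x in W) (#|kids x| == 0%N) = #|[set x in W | #|kids x| == 0%N]|)%N.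
  by rewrite -sum1dep_card big_mkcondr.
have c2 : (\sum_(x in W) (1 < #|kids x|)%N + #|[set x in W | #|kids x| == 0%N]|
           = #|[set x in W | #|kids x| != 1%N]|)%N.
  rewrite -c0 -big_split /= -sum1dep_card big_mkcondr /=.
  by apply: eq_bigr => x _; case: #|kids x| => [|[|n]].
rewrite c0 in H; move: H c2 W0; move: (\sum_(i in W) _)%N => t; clear; lia.
Qed.

Section Branching.
Variable B : {set X}.
Hypothesis subB : forall x, x \in W -> x \notin B -> #|kids x| = 1%N /\ x != r.

(* b is the vertex of B reached from x by following only children; points in the
   middle of the same unbranched path share it. *)
Definition bot x b := [/\ b \in B, b \in W, anc x b &
  forall m, m \in B -> m \in W -> anc x m -> anc b m].

(** Descend through only children until [B] is met; the induction is on the number of descendants. A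
    vertex without children lies in [B], so the descent cannot get stuck. *)
Lemma bot_exists x : x \in W -> exists b, bot x b.
Proof.
move: {2}_.+1 (ltnSn #|[set y in W | anc x y]|) => n.
elim: n x => // n IH x lt xW; case: (boolP (x \in B)) => [xB|xB].
  by exists x; split => //; exact: anc_refl.
have [/eqP/cards1P[y ky] xr] := subB xW xB.
have yk : y \in kids x by rewrite ky set11.
move: (yk); rewrite inE => /and3P[yW yr /eqP py].
have xy : anc x y by rewrite -py; apply: anc_par.
have pN : par y != y by apply: par_neq.
have [|b [bB bW yb bm]] := IH y _ yW.
  rewrite -ltnS; apply: leq_trans lt; rewrite ltnS; apply: proper_card.
  apply/properP; split.
    by apply/subsetP => z; rewrite !inE => /andP[-> yz]; apply: anc_trans yz.
  exists x; rewrite inE xW ?anc_refl //=; apply/negP => yx.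
  by have := anc_height yx; have := height_par pN; rewrite py; lra.
exists b; split => //; first exact: anc_trans yb.
move=> m mB mW xm; apply: bm => //.
have xNm : x != m by apply: contraNneq xB => ->.
by have [k] := kids_toward xm xNm mW; rewrite ky => /set1P ->.
Qed.

Lemma bot_unique x b b' : bot x b -> bot x b' -> b = b'.
Proof.
move=> [bB bW xb bm] [b'B b'W xb' bm'].
by apply: anc_anti; [apply: bm|apply: bm'].
Qed.

Lemma bot_par y b : y \in W -> y != r -> par y \notin B -> bot y b -> bot (par y) b.
Proof.
move=> yW yr pB [bB bW yb bm]; split => //; first exact: anc_trans (anc_par y) yb.
move=> m mB mW pm; apply: bm => //.
have pNm : par y != m by apply: contraNneq pB => ->.
have [k kk km] := kids_toward pm pNm mW.
have [c1 _] := subB (parW yW) pB.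
suff -> : y = k by [].
by apply: unary_kids_eq c1 _ kk; rewrite inE yW yr eqxx.
Qed.

Lemma bot_anc z u b : u \in W -> anc z u ->
  (forall y, anc z y -> anc y u -> y != u -> y \notin B) -> bot u b -> bot z b.
Proof.
move=> uW zu; move: u zu uW; apply: anc_ind => // u zu pu IH uW H bu.
have uNr : u != r by apply: contraNneq pu => ->; rewrite par_root.
apply: IH; first exact: parW.
  move=> y zy yu yNu; apply: H => //; first exact: anc_parW.
  apply/eqP => E; rewrite E in yu.
  by have := anc_height yu; have := height_par pu; lra.
by apply: bot_par => //; apply: H => //; apply: anc_par.
Qed.

(** * Windows around net points *)

Section Windows.
Variables (a s : R) (M : nat).
Hypothesis s_gt0 : 0 < s.
Hypothesis M_gt0 : (0 < M)%N.
Hypothesis aE : a = s * M%:R.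
Hypothesis BW : B \subset W.
Hypothesis short : forall x, x \in W -> x != r -> x \notin B \/ par x \notin B ->
  mdist x (par x) < a / 2.

Let a_gt0 : 0 < a. Proof. by rewrite aE mulr_gt0 ?ltr0n. Qed.

(* When u is bare, [win u] is the interior of an unbranched path around u, and
   [zone u] is the set of the edges that touch it. *)
Definition win u := [set z in W |
  (anc z u && (h u - h z < a)) || (anc u z && (h z - h u < a))].
Definition bare u := [disjoint win u & B].
Definition zone u :=
  [set z in W | (z != r) && ((z \in win u) || (par z \in win u))].

Lemma win_self u : u \in W -> u \in win u.
Proof. by move=> uW; rewrite inE uW anc_refl subrr a_gt0. Qed.

Lemma win_subtree u z : z \in win u -> z \in W.
Proof. by rewrite inE => /andP[]. Qed.

Lemma win_height u z : z \in win u -> `|h z - h u| < a.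
Proof.
rewrite inE ltr_norml => /andP[_ /orP[] /andP[/anc_height H1 H2]].
  by apply/andP; split; have := a_gt0; lra.
by apply/andP; split; have := a_gt0; lra.
Qed.

Lemma win_up u z m : u \in W -> z \in win u -> anc z m -> anc m u -> m \in win u.
Proof.
move=> uW zu zm mu; rewrite inE (anc_subtree mu uW) mu /=.
have := win_height zu; rewrite ltr_norml => /andP[H1 H2].
by apply/orP; left; have := anc_height zm; lra.
Qed.

Lemma win_down u z m : z \in win u -> anc u m -> anc m z -> m \in win u.
Proof.
move=> zu um mz; rewrite inE (anc_subtree mz (win_subtree zu)) um /=.
have := win_height zu; rewrite ltr_norml => /andP[H1 H2].
by apply/orP; right; have := anc_height mz; lra.
Qed.

Lemma bareP u z : bare u -> z \in win u -> z \notin B.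
Proof. by move=> /disjointFr H /H ->. Qed.

(** Every vertex between [u] and [z] lies in the window, hence outside [B], so a bare window is part
    of one unbranched path. *)
Lemma bot_win u z b : u \in W -> bare u -> z \in win u -> bot u b -> bot z b.
Proof.
move=> uW bu zu Hb; have zW := win_subtree zu; have := zu.
rewrite inE => /andP[_ /orP[] /andP[zu' _]].
  apply: bot_anc Hb => // y zy yu _; apply: bareP bu _; exact: win_up zy yu.
have [b' Hb'] := bot_exists zW.
suff Hu : bot u b' by rewrite (bot_unique Hb Hu).
apply: bot_anc Hb' => // y uy yz _; apply: bareP bu _; exact: win_down uy yz.
Qed.

(** A common edge gives either a common vertex of the two windows or two neighbours less than
    [a / 2] apart on one unbranched path. The heights then differ by less than a + a/2 + a. *)
Lemma zone_meet u t z : u \in W -> t \in W -> bare u -> bare t ->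
  z \in zone u -> z \in zone t ->
  exists b, [/\ bot u b, bot t b & `|h u - h t| < 3 * a].
Proof.
move=> uW tW bu bt zu zt.
have a0 := a_gt0.
have [bb Hbu] := bot_exists uW; have [b' Hbt] := bot_exists tW.
suff K : exists x y b1 b2, [/\ x \in win u, y \in win t,
     bot x b1, bot y b2 & b1 = b2 /\ `|h x - h y| < a / 2].
  have [x [y [b1 [b2 [xu yt bx by' [E xy]]]]]] := K.
  have E1 := bot_unique (bot_win uW bu xu Hbu) bx.
  have E2 := bot_unique (bot_win tW bt yt Hbt) by'.
  exists b1; split; [by rewrite -E1|by rewrite E -E2|].
  have := win_height xu; rewrite ltr_norml => /andP[? ?].
  have := win_height yt; rewrite ltr_norml => /andP[? ?].
  move: xy; rewrite !ltr_norml => /andP[? ?]; apply/andP; split; lra.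
have K0 x : x \in win u -> x \in win t ->
   exists x y b1 b2, [/\ x \in win u, y \in win t,
     bot x b1, bot y b2 & b1 = b2 /\ `|h x - h y| < a / 2].
  move=> xu xt; have [b1 H1] := bot_exists (win_subtree xu).
  by exists x, x, b1, b1; rewrite subrr normr0; split => //; split => //; lra.
have hz : h z - h (par z) = mdist z (par z) by rewrite heightE; lra.
have d0 := mdist_ge0 z (par z).
move: zu zt; rewrite !inE => /and3P[zW zr zu] /and3P[_ _ zt].
have [b1 H1] := bot_exists zW.
case/orP: zu => zu; case/orP: zt => zt; rewrite -?inE.
- by apply: (K0 z); rewrite inE.
- have pt : par z \in win t by rewrite inE.
  have zu' : z \in win u by rewrite inE.
  have pB := bareP bt pt.
  exists z, (par z), b1, b1; split => //; first exact: bot_par.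
  by split => //; rewrite ger0_norm hz //; apply: short => //; right.
- have pu : par z \in win u by rewrite inE.
  have zt' : z \in win t by rewrite inE.
  have pB := bareP bu pu.
  exists (par z), z, b1, b1; split => //; first exact: bot_par.
  by split => //; rewrite distrC ger0_norm hz //; apply: short => //; right.
- by apply: (K0 (par z)); rewrite inE.
Qed.

Variable N : {set X}.
Hypothesis NW : N \subset W.
Hypothesis sepN : forall u v, u \in N -> v \in N -> u != v -> s <= mdist u v.

Let N_in_W u : u \in N -> u \in W. Proof. exact: (subsetP NW). Qed.

(** On a single descending path the distance is at most the difference of heights, so separation of
    points becomes separation of heights. *)
Lemma chain_gap b u v : u \in N -> v \in N -> u != v -> anc u b -> anc v b ->
  s <= `|h u - h v|.
Proof.
move=> uN vN uv ub vb; apply: le_trans (sepN uN vN uv) _.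
case: (anc_chain ub vb) => H; have D := anc_dist H.
  by rewrite metric_sym distrC; apply: le_trans D (ler_norm _).
by apply: le_trans D (ler_norm _).
Qed.

(** All these points lie above the bottom of [t], with heights within [3 * a] of that of [t]; so
    they fit in a range of length [6 * a = s * (6 * M)]. *)
Lemma card_zone_meet t : t \in W -> bare t ->
  (#|[set u in N | bare u && ~~ [disjoint zone u & zone t]]| <= 6 * M)%N.
Proof.
move=> tW bt; have a0 := a_gt0.
have [b Hb] := bot_exists tW.
apply: (@card_sep_le _ _ _ h s) => //; first by rewrite muln_gt0.
have K u : u \in [set u in N | bare u && ~~ [disjoint zone u & zone t]] ->
    [/\ u \in N, anc u b & `|h u - h t| < 3 * a].
  rewrite inE => /and3P[uN bu] /pred0Pn[z /andP[/= zu zt]].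
  have [b' [H1 H2 H3]] := zone_meet (N_in_W uN) tW bu bt zu zt.
  by have E := bot_unique Hb H2; case: H1; rewrite -E.
move=> u v /K[uN ub hu] /K[vN vb hv] uv; rewrite (chain_gap uN vN uv ub vb) /=.
rewrite natrM mulrCA -aE; move: hu; rewrite ltr_norml => /andP[? ?].
by move: hv; rewrite !ltr_norml => /andP[? ?]; apply/andP; split; lra.
Qed.

(** A point that is not bare is charged to its bottom [b]. [S1] collects the points less than [a]
    above [b]; those of [S2] are farther from [b], and a vertex of [B] less than [a] above them
    spoils the window. Each kind fits in a height range of length [a]. *)
Lemma card_not_bare : (#|[set u in N | ~~ bare u]| <= #|B| * (2 * M))%N.
Proof.
have a0 := a_gt0.
pose S1 b := [set u in N | anc u b && (h b - h u < a)].
pose S2 b := [set u in N | [&& `[< bot u b >], ~~ (h b - h u < a) &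
  [exists z in B, anc z u && (h u - h z < a)]]].
have BinW b : b \in B -> b \in W by exact: (subsetP BW).
apply: (@card_cover_le _ _ _ _ (fun b => S1 b :|: S2 b)) => [b bB|u].
  have c1 : (#|S1 b| <= M)%N.
    apply: (@card_sep_le _ _ _ h s) => // u v.
    rewrite !inE => /and3P[uN ub hu] /and3P[vN vb hv] uv.
    rewrite (chain_gap uN vN uv ub vb) -aE ltr_norml.
    by have := anc_height ub; have := anc_height vb; lra.
  have c2 : (#|S2 b| <= M)%N.
    apply: (@card_sep_le _ _ _ h s) => //.
    (* If the vertex [z] of [B] above [v] were strictly below [u], then [b] would lie above [z] and
       so above [v], which forces [v = b]. *)
    have K u v : u \in S2 b -> v \in S2 b -> anc u v -> h v - h u < a.
      rewrite !inE => /andP[uN /and3P[/asboolP[_ _ ub bm] hu _]].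
      move=> /andP[vN /and3P[/asboolP[_ _ vb _] hv]].
      case/exists_inP => z zB /andP[zv hz] uv.
      have [le|lt] := leP (h z) (h u); first by lra.
      have uz := anc_chain_lt uv zv lt.
      have bz := bm _ zB (BinW _ zB) uz.
      have E : v = b by apply: anc_anti => //; apply: anc_trans bz zv.
      by rewrite E subrr a0 in hv.
    move=> u v uS vS uv; move: (uS) (vS).
    rewrite !inE => /andP[uN /andP[/asboolP[_ _ ub _] _]].
    move=> /andP[vN /andP[/asboolP[_ _ vb _] _]].
    rewrite (chain_gap uN vN uv ub vb) -aE ltr_norml.
    case: (anc_chain ub vb) => H; have := anc_height H.
      by have := K _ _ uS vS H; lra.
    by have := K _ _ vS uS H; lra.
  by rewrite (leq_trans (leq_card_setU _ _)) // mul2n -addnn leq_add.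
rewrite inE => /andP[uN nb]; have uW := N_in_W uN.
have [b Hb] := bot_exists uW; exists b; first by case: Hb.
have [bB bW ub bm] := Hb.
rewrite !inE uN ub /=; case: ltP => //= hb.
apply/andP; split; first exact/asboolP.
move: nb => /pred0Pn[z /andP[/= zu zB]]; apply/exists_inP; exists z => //.
have := zu; rewrite inE => /andP[zW /orP[//|/andP[uz hz]]].
have := anc_height (bm _ zB zW uz); lra.
Qed.


Lemma win_dist u z : z \in win u -> mdist z u < a.
Proof.
rewrite inE => /andP[_ /orP[] /andP[/anc_dist]]; first by rewrite metric_sym; lra.
lra.
Qed.

Lemma win_nroot u z : bare u -> z \in win u -> z != r.
Proof.
move=> bu zu; have [] := subB (win_subtree zu) (bareP bu zu); by [].
Qed.

Lemma win_unary u z : bare u -> z \in win u -> #|kids z| = 1%N.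
Proof.
move=> bu zu; have [] := subB (win_subtree zu) (bareP bu zu); by [].
Qed.

Lemma win_zone u z : bare u -> z \in win u -> z \in zone u.
Proof. by move=> bu zu; rewrite inE (win_subtree zu) (win_nroot bu zu) zu. Qed.

(** * Replacing tree paths by links *)

Section Surgery.
Variables (G : rel X) (g : R).
Hypothesis symG : symmetric G.
Hypothesis treeG : forall x, x \in W -> x != r -> G x (par x).

Definition zone2 (e : X * X) := zone e.1 :|: zone e.2.

(** [g] is the weight that inserting the link has to save. The last two clauses say that both a
    window half, of length at least [a], and any walk already joining the ends are long enough for
    that. *)
Definition link_ok (e : X * X) : Prop :=
  [/\ e.1 \in W, e.2 \in W, bare e.1, bare e.2 & [/\ e.1 != e.2,
   mdist e.1 e.2 + g <= a &
   forall c, reach G e.1 e.2 c -> mdist e.1 e.2 + g <= c]].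

(* The tree W without the edges in D and with the links in P. *)
Definition cut_graph (D : {set X}) (P : seq (X * X)) : rel X := fun x y =>
  [|| [&& x \in W, x != r, x \notin D & y == par x],
      [&& y \in W, y != r, y \notin D & x == par y],
      (x, y) \in P | (y, x) \in P].

Lemma cut_graph_sym D P : symmetric (cut_graph D P).
Proof.
move=> x y; rewrite /cut_graph.
by case: ((x, y) \in P); case: ((y, x) \in P); rewrite ?orbT ?orbF //= orbC.
Qed.

Lemma cut_connect_sym D P : connect_sym (cut_graph D P).
Proof. exact/sym_connect_sym/cut_graph_sym. Qed.

(* D and Z are the edges and the vertices deleted on behalf of the links in P. *)
Definition surgery_state (P : seq (X * X)) (D Z : {set X}) : Prop :=
  [/\ forall z, z \in D -> exists2 e, e \in P & z \in zone2 e,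
      forall z, z \in Z -> exists2 e, e \in P & (z \in zone2 e) && (mdist z e.1 < a),
      forall e, e \in P -> e.1 \in W /\ e.1 \notin Z,
      forall x, x \in W -> x \notin Z -> connect (cut_graph D P) x r &
      \sum_(e <- P) (mdist e.1 e.2 + g) <= \sum_(z in D) mdist z (par z)].

Section Step.
Variables (P : seq (X * X)) (D Z : {set X}) (u v : X).
Hypothesis st : surgery_state P D Z.
Hypothesis okP : forall e, e \in P -> link_ok e.
Hypothesis ok : link_ok (u, v).
Hypothesis disj : forall e, e \in P -> [disjoint zone2 (u, v) & zone2 e].

Let F := cut_graph D P.

Let uW : u \in W. Proof. by case: ok. Qed.
Let vW : v \in W. Proof. by case: ok. Qed.
Let bu : bare u. Proof. by case: ok. Qed.
Let bv : bare v. Proof. by case: ok. Qed.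

Let zone_fresh z e : z \in zone2 (u, v) -> e \in P -> z \notin zone2 e.
Proof. by move=> zu /disj /disjointFr/(_ zu) ->. Qed.

Let zone_keptD z : z \in zone2 (u, v) -> z \notin D.
Proof.
move=> zz; apply/negP; case: st => H _ _ _ _ /H[e eP].
by apply/negP; apply: zone_fresh.
Qed.

Let zone_keptZ z : z \in zone2 (u, v) -> z \notin Z.
Proof.
move=> zz; apply/negP; case: st => _ H _ _ _ /H[e eP /andP[ze _]].
by move: ze; apply/negP; apply: zone_fresh.
Qed.

Let win_zone2 z : z \in win u -> z \in zone2 (u, v).
Proof. by move=> zu; rewrite inE (win_zone bu zu). Qed.

Let win_nolink z y : z \in win u -> ((z, y) \in P) || ((y, z) \in P) = false.
Proof.
move=> zu; have H := zone_fresh (win_zone2 zu).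
apply/negP => /orP[] zP; have := H _ zP; apply/negP; rewrite negbK inE /=.
  have [zW _ bz _ _] := okP zP.
  by rewrite (win_zone bz (win_self zW)).
have [_ zW _ bz _] := okP zP.
by rewrite (win_zone bz (win_self zW)) orbT.
Qed.

Let rZ : r \notin Z.
Proof.
apply/negP; case: st => _ H _ _ _ /H[e _ /andP[]].
by rewrite !inE eqxx /= !andbF.
Qed.

Let connect_u x : x \in W -> x \notin Z -> connect F x u.
Proof.
move=> xW xZ; case: st => _ _ _ H _; have uZ : u \notin Z.
  by apply/zone_keptZ/win_zone2/win_self.
apply: connect_trans (H _ xW xZ) _; rewrite cut_connect_sym; exact: H.
Qed.

(** The zones being disjoint, the edges of [D'] are new and the savings add up. Connection to [u]
    suffices because the root is never deleted and so is itself still connected to [u]. *)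
Lemma surgery_extend (D' Z' : {set X}) :
  D' \subset zone2 (u, v) -> Z' \subset win u -> u \notin Z' ->
  mdist u v + g <= \sum_(z in D') mdist z (par z) ->
  (forall x, x \in W -> x \notin Z -> x \notin Z' ->
     connect (cut_graph (D :|: D') ((u, v) :: P)) x u) ->
  surgery_state ((u, v) :: P) (D :|: D') (Z :|: Z').
Proof.
move=> D'z Z'w uZ' gain conn; case: (st) => H1 H2 H3 _ H5; split.
- move=> z /setUP[/H1[e eP ze]|/(subsetP D'z) zz].
    by exists e => //; rewrite inE eP orbT.
  by exists (u, v); rewrite ?mem_head.
- move=> z /setUP[/H2[e eP ze]|/(subsetP Z'w) zz].
    by exists e => //; rewrite inE eP orbT.
  by exists (u, v); rewrite ?mem_head // win_zone2 // win_dist.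
- move=> e; rewrite !inE => /orP[/eqP ->|eP] /=.
    rewrite (negPf uZ') orbF uW; split=> //.
    by apply/zone_keptZ/win_zone2/win_self.
  have [eW eZ] := H3 _ eP; rewrite (negPf eZ) /=; split => //.
  apply/negP => /(subsetP Z'w)/win_zone2/zone_fresh/(_ eP); rewrite inE.
  by have [_ _ be _ _] := okP eP; rewrite (win_zone be (win_self eW)).
- move=> x xW; rewrite inE negb_or => /andP[xZ xZ'].
  apply: connect_trans (conn _ xW xZ xZ') _; rewrite cut_connect_sym.
  apply: conn => //; apply/negP => /(subsetP Z'w)/(win_nroot bu).
  by rewrite eqxx.
- rewrite big_cons (big_setID D) /= setUK addrC.
  rewrite setDUl setDv set0U.
  suff -> : D' :\: D = D' by apply: lerD.
  apply/setDidPl; rewrite disjoints_subset; apply/subsetP => z /(subsetP D'z) zz.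
  rewrite inE; exact: zone_keptD zz.
Qed.

(** When the link joins two points of one window, the tree path between its ends exceeds it by [g],
    and the link can replace the whole path. *)
Lemma surgery_shortcut x y :
  ((x, y) == (u, v)) || ((x, y) == (v, u)) -> anc x y ->
  (forall z, anc x z -> anc z y -> z \in win u) ->
  exists D' Z', surgery_state ((u, v) :: P) D' Z'.
Proof.
move=> xyE xy Hw.
have [xW yW] : x \in W /\ y \in W.
  by split; apply: (@win_subtree u); apply: Hw => //; apply: anc_refl.
have gain : mdist u v + g <= h y - h x.
  case: ok => _ _ _ _ [_ _]; apply => /=.
  have rg : reach G y x (h y - h x).
    apply: seg_reach => // z; rewrite inE => /and3P[xz zy _].
    have zw := Hw _ xz zy; apply: treeG; [exact: win_subtree zw|].
    exact: win_nroot zw.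
  case/orP: xyE => /eqP[xE yE]; rewrite xE yE in rg *; last by [].
  exact: reach_sym.
(* [seg x y] consists of the lower ends of the path edges, so removing [y] from it leaves the
   interior vertices. *)
exists (D :|: seg x y), (Z :|: (seg x y :\ y)); apply: surgery_extend.
- by apply/subsetP => z; rewrite inE => /and3P[xz zy _]; exact: win_zone2 (Hw _ xz zy).
- by apply/subsetP => z /setD1P[_]; rewrite inE => /and3P[xz zy _]; exact: Hw.
- rewrite !inE; case/orP: xyE => /eqP[xE yE].
    by rewrite xE eqxx !andbF.
  by rewrite yE eqxx.
- by rewrite seg_sum.
set F' := cut_graph _ _.
have F'S : connect_sym F' by exact: cut_connect_sym.
have lk : connect F' y x.
  apply: connect1; rewrite /F' /cut_graph !in_cons.
  by case/orP: xyE => /eqP[-> ->]; rewrite eqxx /= ?orbT.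
move=> w wW wZ wZ'.
suff [q qQ cq] : exists2 q, q \in [set x; y] & connect F' w q.
  have hub q' : q' \in [set x; y] -> connect F' q' x.
    by case/set2P => -> //; exact: connect0.
  apply: connect_trans cq _; apply: connect_trans (hub _ qQ) _.
  rewrite F'S; apply: hub; rewrite !inE; case/orP: xyE => /eqP[-> ->];
  by rewrite eqxx ?orbT.
(* The interior vertices are unary and carry no earlier link, so the path can be entered only
   through [x] or [y]. *)
apply: (@connect_retract _ F F' (seg x y :\ y) _ _ w u) => //; last 2 first.
- exact: connect_u.
- rewrite !inE; case/orP: xyE => /eqP[-> ->]; by rewrite eqxx ?orbT.
move=> p q Fpq pZ'; case: (boolP (p \in [set x; y])) => pxy; [by left|right].
have pD : p \notin seg x y.
  apply/negP => pS; move: pZ' pxy; rewrite inE pS andbT negbK inE.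
  by move=> /eqP ->; rewrite !inE eqxx orbT.
move: Fpq; rewrite /F /cut_graph => /or4P[].
- move=> /and4P[pW pr pD0 /eqP qE]; split; last first.
    apply: connect1; rewrite /F' /cut_graph pW pr qE eqxx andbT inE.
    by rewrite (negPf pD0) (negPf pD).
  apply/negP; rewrite !inE => /and4P[qy xq qy' qx].
  have qw := Hw _ xq qy'.
  have [k kk ky] := kids_toward qy' qy yW.
  have pk : p = k.
    by apply: unary_kids_eq (win_unary bu qw) _ kk; rewrite inE pW pr qE eqxx.
  case/negP: pD; rewrite inE pk ky -pk; rewrite qE in xq.
  rewrite (anc_parW xq) /=; apply: contraNneq pxy => ->.
  by rewrite !inE eqxx.
- move=> /and4P[qW qr qD0 /eqP pE].
  have qD : q \notin seg x y.
    apply/negP; rewrite inE => /and3P[xq qy qx].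
    have xp : anc x p by rewrite pE; case: (anc_step xq) => // E; rewrite E eqxx in qx.
    case/negP: pD; rewrite inE xp /=; apply/andP; split.
      by rewrite pE; apply: anc_trans (anc_par q) qy.
    by apply: contraNneq pxy => ->; rewrite !inE eqxx.
  split; first by rewrite inE (negPf qD) andbF.
  apply: connect1; rewrite /F' /cut_graph qW qr pE eqxx andbT.
  by rewrite [q \in D :|: _]inE (negPf qD0) (negPf qD) /= ?orbT.
- move=> pqP; split.
    apply/negP; rewrite !inE => /and4P[_ xq qy _].
    by have := win_nolink p (Hw _ xq qy); rewrite pqP orbT.
  by apply: connect1; rewrite /F' /cut_graph !in_cons pqP !orbT.
- move=> pqP; split.
    apply/negP; rewrite !inE => /and4P[_ xq qy _].
    by have := win_nolink p (Hw _ xq qy); rewrite pqP.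
  by apply: connect1; rewrite /F' /cut_graph !in_cons pqP !orbT.
Qed.

(* Outside of the path around u every vertex is connected to one of its two ends
   p and q.  If v is connected to p, the link (u, v) makes the half of the path
   between p and u superfluous, and otherwise the other half. *)
Lemma surgery_detour : v \notin win u ->
  exists D' Z', surgery_state ((u, v) :: P) D' Z'.
Proof.
move=> vu; have a0 := a_gt0.
have gain : mdist u v + g <= a by case: ok => _ _ _ _ [].
(* The window contains neither the root nor the bottom [b], so the unbranched path extends by at
   least [a] on both sides of [u]. *)
have ur : a <= h u - h r.
  rewrite leNgt; apply/negP => lt.
  have : r \in win u by rewrite inE rootW treeW //= lt.
  by move/(win_nroot bu); rewrite eqxx.
have [p [pu pa pseg]] := first_above a0 (treeW uW) ur.
have [b [bB bW ub bm]] := bot_exists uW.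
have ba : a <= h b - h u.
  rewrite leNgt; apply/negP => lt.
  have : b \in win u by rewrite inE bW ub lt orbT.
  by move/(bareP bu); rewrite bB.
have [q [uq qb qa qmin]] : exists q, [/\ anc u q, anc q b, a <= h q - h u &
    forall y, anc u y -> anc y q -> y != q -> h y - h u < a].
  have P0 : [pred y | [&& anc u y, anc y b & a <= h y - h u]] b.
    by rewrite /= ub anc_refl.
  case: (arg_minP h P0) => q /= /and3P[uq qb qa] qmin; exists q; split => //.
  move=> y uy yq yNq; rewrite ltNge; apply/negP => ya.
  have := qmin y; rewrite /= uy ya (anc_trans yq qb) => /(_ isT).
  by rewrite leNgt anc_height_lt.
have qW := anc_subtree qb bW.
have up z : z \in win u -> anc z u -> z \in seg p u.
  move=> zw zu; have := win_height zw; rewrite ltr_norml => /andP[hz _].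
  have pz : anc p z by apply: anc_chain_lt pu zu _; lra.
  rewrite inE pz zu; apply: contraTneq pa => <-; rewrite -ltNge; lra.
have segup z : z \in seg p u -> z \in win u.
  move=> zs; have hz := pseg _ zs; move: zs; rewrite inE => /and3P[pz zu _].
  by rewrite inE (anc_subtree zu uW) zu hz.
have uppar z : z \in win u -> anc z u -> par z \notin win u -> par z = p.
  move=> zw zu pzw; apply/eqP/negPn/negP => pzp.
  have := up _ zw zu; rewrite inE => /and3P[pz _ zp].
  have ppz : anc p (par z) by case: (anc_step pz) => // E; rewrite E eqxx in zp.
  case/negP: pzw; apply: segup; rewrite inE ppz pzp andbT.
  exact: anc_trans (anc_par z) zu.
have down z : z \in win u -> anc u z -> anc z q /\ z != q.
  move=> zw uz; have := win_height zw; rewrite ltr_norml => /andP[_ hz].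
  have zNq : z != q by apply: contraTneq qa => <-; rewrite -ltNge; lra.
  split => //.
  case: (unary_comparable (win_subtree zw) qW uz uq) => // [m um mz _|qz].
    apply: (win_unary bu); exact: win_down um mz.
  by have := anc_height qz; lra.
have segdown z : z \in seg u q -> par z \in win u.
  rewrite inE => /and3P[uz zq zu].
  have up' : anc u (par z) by case: (anc_step uz) => // E; rewrite E eqxx in zu.
  have zW := anc_subtree zq qW.
  have zr : z != r.
    apply/eqP => E; rewrite E in uz; have := anc_root uz => E'.
    by rewrite E E' eqxx in zu.
  have lt := height_par (par_neq zW zr).
  rewrite inE (parW zW) up' (qmin _ up') ?orbT //.
    exact: anc_trans (anc_par z) zq.
  by apply/eqP => E; have := anc_height zq; rewrite -E; lra.
have segdown' z : z \in seg u q -> z != q -> z \in win u.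
  rewrite inE => /and3P[uz zq zu] zNq.
  by rewrite inE (anc_subtree zq qW) uz qmin // orbT.
have downkid w : w \in W -> w != r -> par w \in win u -> w \notin win u -> w = q.
  move=> wW wr pw wN; set z := par w in pw.
  have wk : w \in kids z by rewrite inE wW wr eqxx.
  have un := win_unary bu pw.
  have uz : anc u z.
    have := pw; rewrite inE => /andP[_ /orP[] /andP[zu hz] //].
    have [<-|zNu] := eqVneq z u; first exact: anc_refl.
    have [k kk ku] := kids_toward zu zNu uW.
    case/negP: wN; rewrite (unary_kids_eq un wk kk).
    apply: win_up pw _ ku => //; rewrite inE in kk.
    by case/and3P: kk => _ _ /eqP <-; exact: anc_par.
  have [zq zNq] := down _ pw uz.
  have [k kk kq] := kids_toward zq zNq qW.
  have E := unary_kids_eq un wk kk; rewrite -E in kq.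
  apply/eqP/negPn/negP => wNq; case/negP: wN.
  have uw : anc u w by apply: anc_parW.
  by rewrite inE wW uw qmin // orbT.
(* The window has only the two gates [p] and [q]. *)
have nbr x y : F x y -> x \notin win u -> y \in win u -> x \in [set p; q].
  rewrite /F /cut_graph => Fxy xN yw; rewrite !inE; move: Fxy => /or4P[].
  - move=> /and4P[xW xr _ /eqP yE]; rewrite yE in yw.
    by rewrite (downkid x) ?eqxx ?orbT.
  - move=> /and4P[yW yr _ /eqP xE]; rewrite xE in xN.
    have := yw; rewrite inE => /andP[_ /orP[] /andP[yu _]].
      by rewrite xE (uppar y) // eqxx.
    have [E|uy] := anc_step yu.
      by rewrite xE (uppar y) ?eqxx // E anc_refl.
    by case/negP: xN; apply: win_down yw uy (anc_par y).
  - by move=> xyP; have := win_nolink x yw; rewrite xyP orbT.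
  - by move=> xyP; have := win_nolink x yw; rewrite xyP.
(* [Fm] lives outside the window, so it survives the deletion of either half. *)
pose Fm : rel X := fun x y => [&& F x y, x \notin win u & y \notin win u].
have reachpq x : x \in W -> x \notin Z -> x \notin win u ->
    exists2 e, e \in [set p; q] & connect Fm x e.
  move=> xW xZ xw.
  apply: (@connect_retract _ F Fm (win u) _ _ x u) => //.
  - move=> x' y Fxy xN; case: (boolP (y \in win u)) => yw.
      by left; apply: nbr yw.
    by right; split => //; apply: connect1; rewrite /Fm Fxy xN yw.
  - exact: connect_u.
  - by rewrite inE win_self.
have FmS : connect_sym Fm.
  apply: sym_connect_sym => x y; rewrite /Fm /F cut_graph_sym.
  by case: (x \in win u); case: (y \in win u); rewrite ?andbF.
have Fsub (D' : {set X}) : (forall z, z \in D' -> z \in win u \/ par z \in win u) ->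
    forall x y, connect Fm x y -> connect (cut_graph (D :|: D') ((u, v) :: P)) x y.
  move=> HD'; apply: connect_sub => x y /and3P[].
  rewrite /F /cut_graph => Fxy xN yN; apply: connect1; rewrite !in_cons.
  have HD z : z \notin win u -> par z \notin win u -> z \notin D -> z \notin D :|: D'.
    move=> zN pN zD; rewrite inE (negPf zD) /=; apply/negP => /HD'[].
      by apply/negP.
    by apply/negP.
  move: Fxy => /or4P[/and4P[xW xr xD /eqP yE]|/and4P[yW yr yD /eqP xE]|->|->];
    rewrite ?orbT //.
    by apply/orP; left; rewrite xW xr yE eqxx andbT; apply: HD => //; rewrite -yE.
  apply/orP; right; apply/orP; left.
  by rewrite yW yr xE eqxx andbT; apply: HD => //; rewrite -xE.
have lk (D' : {set X}) : connect (cut_graph (D :|: D') ((u, v) :: P)) v u.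
  by apply: connect1; rewrite /cut_graph !in_cons !eqxx !orbT.
have vZ : v \notin Z.
  by apply: zone_keptZ; rewrite inE (win_zone bv (win_self vW)) orbT.
have chain (D' : {set X}) z w : anc z w -> w \in W ->
    (forall y, y \in seg z w -> (y \in seg p u) || (y \in seg u q)) ->
    (forall y, y \in seg z w -> y \notin D') ->
    connect (cut_graph (D :|: D') ((u, v) :: P)) w z.
  move=> zw wW sD sD'; apply: (@reach_connect _ w z (h w - h z)).
  apply: seg_reach => // y ys.
  have yW : y \in W by apply: (anc_subtree _ wW); move: ys; rewrite inE => /and3P[].
  have yr : y != r.
    apply/eqP => E; move: ys; rewrite inE E => /and3P[zr _].
    by rewrite (anc_root zr) eqxx.
  have yz : y \in zone2 (u, v).
    case/orP: (sD _ ys) => H; first exact/win_zone2/segup.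
    have yu : y \in zone u by rewrite inE yW yr segdown ?orbT.
    by rewrite inE yu.
  by rewrite /cut_graph yW yr eqxx inE negb_or (zone_keptD yz) sD'.
have pqE (e0 : X) : e0 \in [set p; q] -> e0 = p \/ e0 = q.
  by case/set2P; [left|right].
(* The half to delete is the one between [u] and the end to which [v] is connected: that end then
   reaches [u] through the link, and the other end through the half that is kept. *)
have [e epq ce] := reachpq _ vW vZ vu.
have [E|E] := pqE _ epq; rewrite {}E {e epq} in ce.
- exists (D :|: seg p u), (Z :|: (seg p u :\ u)); apply: surgery_extend.
  + by apply/subsetP => z /segup; exact: win_zone2.
  + by apply/subsetP => z /setD1P[_ /segup].
  + by rewrite !inE eqxx.
  + by rewrite seg_sum //; lra.
  have sub : forall z, z \in seg p u -> z \in win u \/ par z \in win u.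
    by move=> z /segup; left.
  have dis y : y \in seg u q -> y \notin seg p u.
    rewrite !inE => /and3P[uy _ yu]; apply/negP => /and3P[_ yu' _].
    by rewrite (anc_anti yu' uy) eqxx in yu.
  move=> x xW xZ xZ'.
  case: (boolP (x \in win u)) => xw.
    have ux : anc u x.
      have := xw; rewrite inE => /andP[_ /orP[] /andP[xu _] //].
      have xs := up _ xw xu; move: xZ'; rewrite in_setD1 xs andbT negbK => /eqP ->.
      exact: anc_refl.
    have [xq _] := down _ xw ux.
    have sq y : y \in seg u x -> y \in seg u q.
      by rewrite !inE => /and3P[-> yx ->]; rewrite (anc_trans yx xq).
    apply: chain => // y /sq; first by move=> ->; rewrite orbT.
    exact: dis.
  have [e /pqE[->|->] ce'] := reachpq _ xW xZ xw.
    apply: connect_trans (Fsub _ sub _ _ ce') _.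
    apply: connect_trans (lk _); apply: (Fsub _ sub); by rewrite FmS.
  apply: connect_trans (Fsub _ sub _ _ ce') _.
  by apply: chain => // y ->; rewrite orbT.
- exists (D :|: seg u q), (Z :|: (seg u q :\ q)); apply: surgery_extend.
  + apply/subsetP => z zs; have pz := segdown _ zs.
    have zW : z \in W by apply: (anc_subtree _ qW); move: zs; rewrite inE => /and3P[].
    have zr : z != r.
      apply/eqP => E; move: zs; rewrite inE E => /and3P[ur' _].
      by rewrite (anc_root ur') eqxx.
    have zu : z \in zone u by rewrite inE zW zr pz orbT.
    by rewrite inE zu.
  + by apply/subsetP => z /setD1P[zq zs]; apply: segdown'.
  + by rewrite !inE eqxx !andbF.
  + by rewrite seg_sum //; lra.
  have sub : forall z, z \in seg u q -> z \in win u \/ par z \in win u.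
    by move=> z /segdown; right.
  have dis y : y \in seg p u -> y \notin seg u q.
    rewrite !inE => /and3P[_ yu' _]; apply/negP => /and3P[uy _ yu].
    by rewrite (anc_anti yu' uy) eqxx in yu.
  have ru : connect (cut_graph (D :|: seg u q) ((u, v) :: P)) u p.
    by apply: chain => // y ->.
  have S := cut_connect_sym (D :|: seg u q) ((u, v) :: P).
  move=> x xW xZ xZ'.
  case: (boolP (x \in win u)) => xw.
    have xu : anc x u.
      have := xw; rewrite inE => /andP[_ /orP[] /andP[ux _] //].
      have [xq xNq] := down _ xw ux.
      move: xZ'; rewrite !inE xNq ux xq /= negbK => /eqP ->; exact: anc_refl.
    have := up _ xw xu; rewrite inE => /and3P[px _ xNp].
    have sq y : y \in seg x u -> y \in seg p u.
      rewrite !inE => /and3P[xy yu yx]; rewrite (anc_trans px xy) yu /=.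
      apply/eqP => E; rewrite E in xy.
      by rewrite E (anc_anti px xy) eqxx in yx.
    rewrite S; apply: chain => // y /sq; first by move=> ->.
    exact: dis.
  have [e /pqE[->|->] ce'] := reachpq _ xW xZ xw.
    by apply: connect_trans (Fsub _ sub _ _ ce') _; rewrite S.
  apply: connect_trans (Fsub _ sub _ _ ce') _.
  apply: connect_trans (lk _); apply: (Fsub _ sub); by rewrite FmS.
Qed.

Lemma surgery_step : exists D' Z', surgery_state ((u, v) :: P) D' Z'.
Proof.
case: (boolP (v \in win u)) => [vu|]; last exact: surgery_detour.
have := vu; rewrite inE => /andP[_ /orP[] /andP[vu' _]].
  apply: (@surgery_shortcut v u) => //; first by rewrite eqxx orbT.
  by move=> z vz zu; apply: win_up vu vz zu.
apply: (@surgery_shortcut u v) => //; first by rewrite eqxx.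
by move=> z uz zv; apply: win_down vu uz zv.
Qed.

End Step.

Lemma surgery_exists (P : seq (X * X)) :
  (forall e, e \in P -> link_ok e) ->
  pairwise (fun e e' => [disjoint zone2 e & zone2 e']) P ->
  exists D Z, surgery_state P D Z.
Proof.
elim: P => [|[u v] P IH] okP /=.
  move=> _; exists set0, set0; split => //.
  - by move=> z; rewrite inE.
  - by move=> z; rewrite inE.
  - move=> x xW _; apply: (@reach_connect _ x r (h x - h r)).
    apply: seg_reach => [|y]; first exact: treeW.
    rewrite inE => /and3P[_ yx yr].
    by rewrite /cut_graph (anc_subtree yx xW) yr inE eqxx.
  - by rewrite big_nil big_set0.
move=> /andP[/allP dis pw].
have okP' e : e \in P -> link_ok e by move=> eP; apply: okP; rewrite inE eP orbT.
have [D [Z st]] := IH okP' pw.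
by apply: surgery_step st _ _ _ => //; apply: okP; rewrite mem_head.
Qed.


(** * A maximal family of disjoint links *)

Section Family.
Variable E : rel X.
Hypothesis E_link : forall u v, E u v -> [/\ u \in N, v \in N, u != v,
  mdist u v + g <= a & forall c, reach G u v c -> mdist u v + g <= c].

(** In a maximal family of links with disjoint zones, every link has an end that is not bare or
    whose zone meets that of an end of a chosen link. Each chosen link has two ends, each met by at
    most [6 * M] net points. *)
Lemma link_family : exists (P : seq (X * X)) (A : {set X}),
  [/\ forall e, e \in P -> link_ok e /\ E e.1 e.2,
      pairwise (fun e e' => [disjoint zone2 e & zone2 e']) P,
      uniq P,
      forall u v, E u v -> u \in A \/ v \in A &
      (#|A| <= #|B| * (2 * M) + size P * (12 * M))%N].
Proof.
have NinW u : u \in N -> u \in W by exact: (subsetP NW).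
pose Es := [set e : X * X | [&& E e.1 e.2, bare e.1 & bare e.2]].
have Es_ok e : e \in Es -> link_ok e /\ E e.1 e.2.
  rewrite inE => /and3P[Ee b1 b2]; split => //.
  by have [uN vN uv da rc] := E_link Ee; split; rewrite ?NinW.
pose Q (S : {set X * X}) := (S \subset Es) && [forall p in S, forall q in S,
  (p != q) ==> [disjoint zone2 p & zone2 q]].
have Q0 : Q set0 by rewrite /Q sub0set; apply/forall_inP => p; rewrite inE.
have [S /maxsetP[/andP[SE /forall_inP SP] Smax] _] := maxset_exists Q0.
have Sd p q : p \in S -> q \in S -> p != q -> [disjoint zone2 p & zone2 q].
  by move=> pS qS pq; have /forall_inP/(_ _ qS)/implyP/(_ pq) := SP _ pS.
pose near u t := ~~ [disjoint zone u & zone t].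
pose A3 := [set u in N | bare u && [exists q in S, near u q.1 || near u q.2]].
exists (enum S), ([set u in N | ~~ bare u] :|: A3); split.
- by move=> e; rewrite mem_enum => /(subsetP SE); exact: Es_ok.
- have : {subset enum S <= S} by move=> p; rewrite mem_enum.
  have := enum_uniq S; elim: (enum S) => //= p l IH /andP[pl ul] sub.
  rewrite IH //; last by move=> q ql; apply: sub; rewrite inE ql orbT.
  rewrite andbT; apply/allP => q ql; apply: Sd; first exact/sub/mem_head.
    by apply: sub; rewrite inE ql orbT.
  by apply: contraNneq pl => ->.
- exact: enum_uniq.
- move=> u v uv; have [uN vN uNv da rc] := E_link uv; rewrite !in_setU.
  case: (boolP (bare u)) => bu; last by left; rewrite inE uN bu.
  case: (boolP (bare v)) => bv; last by right; rewrite inE vN bv.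
  have eE : (u, v) \in Es by rewrite inE uv bu bv.
  have [q qS meet] : exists2 q, q \in S & ~~ [disjoint zone2 (u, v) & zone2 q].
    case: (pickP [pred q in S | ~~ [disjoint zone2 (u, v) & zone2 q]]) => [q /andP[qS mq]|H].
      by exists q.
    have far q : q \in S -> [disjoint zone2 (u, v) & zone2 q].
      by move=> qS; have := H q; rewrite /= qS /= => /negbFE.
    have uz : u \in zone2 (u, v) by rewrite inE win_zone ?win_self ?NinW.
    exists (u, v); last by apply/pred0Pn; exists u; rewrite /= uz.
    rewrite -(Smax ((u, v) |: S)) ?setU11 ?subsetUr //.
    apply/andP; split; first by rewrite subUset sub1set eE.
    apply/forall_inP => p /setU1P pS; apply/forall_inP => q /setU1P qS.
    apply/implyP => pq; case: pS qS => [pE|pS] [qE|qS].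
    + by move: pq; rewrite pE qE eqxx.
    + by rewrite pE far.
    + by rewrite qE disjoint_sym far.
    + exact: Sd.
  move: meet => /pred0Pn[z /andP[/= /setUP zz /setUP zq]].
  have nearq w : z \in zone w -> near w q.1 || near w q.2.
    move=> zw; apply/orP; case: zq => zq; [left|right];
    by apply/pred0Pn; exists z; rewrite /= zw zq.
  case: zz => /= /nearq Hq; [left|right]; rewrite [X in _ || X]inE ?uN ?vN ?bu ?bv /=;
  by apply/orP; right; apply/exists_inP; exists q.
- apply: leq_trans (leq_card_setU _ _) _; apply: leq_add; first exact: card_not_bare.
  rewrite -cardE.
  apply: (@card_cover_le _ _ _ _ (fun q : X * X =>
    [set u in N | bare u && near u q.1] :|: [set u in N | bare u && near u q.2])).
    move=> q /(subsetP SE); rewrite inE => /and3P[Eq b1 b2].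
    have [uN vN _ _ _] := E_link Eq.
    have -> : (12 * M = 6 * M + 6 * M)%N by rewrite -mulnDl.
    apply: leq_trans (leq_card_setU _ _) _.
    by apply: leq_add; apply: card_zone_meet => //; apply: NinW.
  move=> u; rewrite inE => /and3P[uN bu /exists_inP[q qS nq]]; exists q => //.
  by rewrite !inE uN bu.
Qed.

End Family.

End Surgery.

End Windows.
End Branching.
End Subtree.
End RootedTree.

(** * One scale *)

Section SpanningTree.
Context {R : realType} {X : finMetricType R}.
Implicit Types x y z u v : X.

(** The rank is the number of edges of a shortest walk from [r]; the last vertex but one of such a
    walk has smaller rank. *)
Lemma bfs_rank (F : rel X) r : exists n : X -> nat, forall x,
  connect F r x -> x != r ->
  exists y, [/\ F y x, connect F r y & (n y < n x)%N].
Proof.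
have K x : exists k, connect F r x -> exists2 p, path F r p /\ last r p = x &
    size p = k /\ forall p', path F r p' -> last r p' = x -> (k <= size p')%N.
  have [c|nc] := boolP (connect F r x); last by exists 0%N.
  have ex : exists k, `[< exists2 p, path F r p /\ last r p = x & size p = k >].
    by case/connectP: c => p pp lp; exists (size p); apply/asboolP; exists p.
  exists (ex_minn ex) => _; case: ex_minnP => k /asboolP[p pp sp] kmin.
  by exists p => //; split => // p' pp' lp'; apply: kmin; apply/asboolP; exists p'.
have [n Hn] := choice K; exists n => x cx xr.
have [p [pp lp] [sp _]] := Hn x cx.
case/lastP: p pp lp sp => [|p z] /=; first by move=> _ E; rewrite E eqxx in xr.
rewrite rcons_path last_rcons size_rcons => /andP[pp Fz] zx sp; rewrite zx in Fz.
exists (last r p); have cy : connect F r (last r p) by apply/connectP; exists p.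
by split => //; rewrite -sp ltnS; have [_ _ [_]] := Hn _ cy; apply.
Qed.

Lemma rooted_spanning_tree (F : rel X) r : symmetric F ->
  exists (par : X -> X) (h : X -> R),
  [/\ par r = r, forall x, h x = h (par x) + mdist x (par x),
      forall x, connect F r x -> anc par r x &
      forall x, anc par r x -> x != r -> F x (par x)].
Proof.
move=> sF; have [n Hn] := bfs_rank F r.
have K x : exists y, (connect F r x -> x != r ->
    [/\ F y x, connect F r y & (n y < n x)%N]) /\
    (~~ connect F r x || (x == r) -> y = x).
  case: (boolP (connect F r x && (x != r))) => [/andP[cx xr]|H].
    have [y Hy] := Hn x cx xr; exists y; split => //.
    by rewrite cx (negPf xr).
  by exists x; split => // cx xr; rewrite cx xr in H.
have [par Hp] := choice K.
have pr : par r = r by have [_] := Hp r; rewrite eqxx orbT; apply.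
(* [N] bounds all the ranks, so [N] steps of [par] end in a fixed point and the height below sums
   the whole path to it. *)
pose N := (\sum_x n x)%N.
have nN x : (n x <= N)%N by rewrite /N (bigD1 x) //= leq_addr.
have it k x : connect F r x -> (n x <= k)%N -> iter k par x = r.
  elim: k x => [|k IH] x cx nx.
    have [->|xr] := eqVneq x r; first by [].
    have [/(_ cx xr)[_ _]] := Hp x; by move: nx; rewrite leqn0 => /eqP ->.
  rewrite iterSr; have [->|xr] := eqVneq x r.
    by rewrite pr iter_fix.
  have [/(_ cx xr)[_ cy ny] _] := Hp x; apply: IH => //.
  by rewrite -ltnS; apply: leq_trans nx.
have fixN x : par (iter N par x) = iter N par x.
  have [cx|ncx] := boolP (connect F r x); first by rewrite it.
  have px : par x = x by have [_] := Hp x; rewrite ncx; apply.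
  by rewrite iter_fix.
exists par, (fun x => \sum_(i < N) mdist (iter i par x) (iter i.+1 par x)).
split => // [x|x cx|x ax xr].
- have -> : \sum_(i < N) mdist (iter i par x) (iter i.+1 par x) =
     \sum_(i < N.+1) mdist (iter i par x) (iter i.+1 par x).
    by rewrite big_ord_recr /= fixN mdistxx addr0.
  rewrite big_ord_recl /= addrC; congr (_ + _); apply: eq_bigr => i _.
  by rewrite -!iterSr.
- by rewrite -(it N x cx (nN x)); apply: fconnect_iter.
- have [cx|ncx] := boolP (connect F r x); last first.
    have px : par x = x by have [_] := Hp x; rewrite ncx; apply.
    by move: ax xr => /iter_findex; rewrite iter_fix // => ->; rewrite eqxx.
  by have [/(_ cx xr)[Fx _ _] _] := Hp x; rewrite sF.
Qed.

End SpanningTree.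

(** * Pruning and rerouting a tree *)

Section Reduction.
Context {R : realType} {X : finMetricType R}.
Implicit Types x y z u v : X.

Definition separated (s : R) (N : {set X}) : Prop :=
  forall u v, u \in N -> v \in N -> u != v -> s <= mdist u v.

Definition covered (c : R) (U N : {set X}) : Prop :=
  forall x, x \in U -> exists2 y, y \in N & mdist x y <= c.

(** The range from [L] to [8 * L] leaves room around distances between [2 * L] and [4 * L] when
    their ends are moved to net points. *)
Definition missing (G : rel X) (N : {set X}) (L e : R) : rel X := fun u v =>
  [&& u \in N, v \in N, L <= mdist u v, mdist u v <= 8 * L &
      ~~ `[< reach G u v ((1 + e) * mdist u v) >]].

(* Each vertex of Lf is a leaf of W below which a branch of length c was pruned
   from U. *)
Lemma prune_leaves (par : X -> X) (h : X -> R) r (W U : {set X}) (c : R)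
    (Lf : {set X}) :
  par r = r -> (forall x, h x = h (par x) + mdist x (par x)) ->
  (forall x, x \in W -> par x \in W) ->
  (forall x, x \in U = anc par r x) -> W \subset U ->
  (forall x, x \in Lf -> [/\ x \in W, #|kids par r W x| = 0%N &
     exists y, [/\ y \in U, anc par x y & c <= h y - h x]]) ->
  #|Lf|%:R * c <= \sum_(z in U :\: W) mdist z (par z).
Proof.
move=> pr hE pW UE WU LfP.
have K x : exists y, x \in Lf -> [/\ y \in U, anc par x y & c <= h y - h x].
  have [xL|] := boolP (x \in Lf); last by exists x.
  by have [_ _ [y Hy]] := LfP x xL; exists y.
have [yf Hy] := choice K.
have noW x z : x \in Lf -> z \in W -> anc par x z -> x = z.
  move=> xL zW xz; apply/eqP/negPn/negP => ne.
  have [k kk _] := kids_toward pr pW xz ne zW.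
  have [_ /eqP] := LfP x xL; rewrite cards_eq0 => /eqP E.
  by rewrite E inE in kk.
apply: (@le_trans _ _ (\sum_(x in Lf) \sum_(z in seg par x (yf x)) mdist z (par z))).
  rewrite mulr_natl -sumr_const; apply: ler_sum => x xL.
  by have [_ xy cy] := Hy x xL; rewrite (seg_sum hE).
apply: disjoint_sum => [z|x xL|x x' z xL x'L]; first exact: mdist_ge0.
  apply/subsetP => z; rewrite inE => /and3P[xz zy zx].
  have [yU _ _] := Hy x xL; rewrite inE; apply/andP; split.
    by apply: contra zx => zW; rewrite (noW x z).
  by rewrite UE; apply: (anc_in_tree pr zy); rewrite -UE.
rewrite !inE => /and3P[xz _ _] /and3P[x'z _ _].
have [xW _ _] := LfP x xL; have [x'W _ _] := LfP x' x'L.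
by case: (anc_chain xz x'z) => H; [apply: noW | apply/esym/noW].
Qed.


Lemma missing_sym (G : rel X) N L e : symmetric G -> symmetric (missing G N L e).
Proof.
move=> sG x y; rewrite /missing (metric_sym y x) andbCA; congr [&& _, _, _, _ & ~~ _].
by apply: asbool_equiv_eq; split; apply: reach_sym.
Qed.

Lemma weight_cut_graph (par : X -> X) r (W D : {set X}) (P : seq (X * X)) :
  uniq P -> D \subset W :\ r ->
  weight (cut_graph par r W D P) <=
  \sum_(x in W :\ r) mdist x (par x) - \sum_(x in D) mdist x (par x)
    + \sum_(e <- P) mdist e.1 e.2.
Proof.
move=> uP DW.
pose T : rel X := fun x y => ((x \in (W :\ r) :\: D) && (y == par x)) || ((x, y) \in P).
apply: le_trans (weight_le_directed (D := T) _) _.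
  move=> x y /or4P[/and4P[xW xr xD yE]|/and4P[xW xr xD yE]|xyP|xyP];
    rewrite /T !inE ?xW ?xr ?xD ?yE ?xyP ?orbT //.
rewrite (big_setID D (A := W :\ r)) /= (setIidPr DW).
set s0 := \sum_(x in D) _; rewrite [s0 + _]addrC addrK.
have -> : \sum_(e <- P) mdist e.1 e.2 = \sum_(p : X * X | p \in P) mdist p.1 p.2.
  by rewrite big_uniq.
have -> : \sum_(x in (W :\ r) :\: D) mdist x (par x) =
   \sum_(p : X * X | (p.1 \in (W :\ r) :\: D) && (p.2 == par p.1)) mdist p.1 p.2.
  rewrite -(pair_big_dep (mem ((W :\ r) :\: D)) (fun x y => y == par x)
    (fun x y => mdist x y)) /=.
  by apply: eq_bigr => x _; rewrite big_pred1_eq.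
rewrite big_mkcond [X in X + _]big_mkcond [X in _ + X]big_mkcond -big_split /=.
apply: ler_sum => -[x y] _; rewrite /T /=; have := mdist_ge0 x y.
case: ((x, y) \in P); case: (x \in _); case: (y == par x) => //=; lra.
Qed.

(** The three terms bounding [#|A|] pay for the leaves of [W] through the branches pruned below
    them, for the long edges, and for the links of the family through the weight lost in the
    surgery. *)
Lemma reduce_tree (par : X -> X) (h : X -> R) r (W U : {set X}) (G : rel X)
    (s a L e : R) (M : nat) (N : {set X}) :
  par r = r -> (forall x, h x = h (par x) + mdist x (par x)) ->
  r \in W -> (forall x, x \in W -> par x \in W) ->
  (forall x, x \in W -> anc par r x) ->
  (forall x, x \in U = anc par r x) -> W \subset U ->
  symmetric G -> (forall x, x \in W -> x != r -> G x (par x)) ->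
  0 < s -> (0 < M)%N -> a = s * M%:R -> 0 < L -> 9 * L <= a -> 0 < e -> e <= 1 ->
  N \subset W -> separated s N ->
  (forall x, x \in W -> #|kids par r W x| = 0%N -> x != r ->
     mdist x (par x) < a / 2 ->
     exists y, [/\ y \in U, anc par x y & a / 2 <= h y - h x]) ->
  exists (A V' : {set X}) (F' : rel X),
  [/\ forall u v, missing G N L e u v -> u \in A \/ v \in A,
      [/\ symmetric F', irreflexive F' &
          forall x y, F' x y -> G x y || missing G N L e x y],
      [/\ V' != set0, {in V' &, forall x y, connect F' x y} & covered a W V'],
      weight F' <= \sum_(x in W :\ r) mdist x (par x) &
      #|A|%:R <= 8 / s * \sum_(z in U :\: W) mdist z (par z) +
        8 * M%:R * #|[set x in W | (x != r) && (a / 2 <= mdist x (par x))]|%:R +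
        12 * M%:R / (e * L) *
          (\sum_(x in W :\ r) mdist x (par x) - weight F')].
Proof.
move=> pr hE rW pW tW UE WU sG tG s0 M0 aE L0 La e0 e1 NW sepN leafP.
have a0 : 0 < a by lra.
set Lg := [set x in W | _].
set rem := \sum_(z in U :\: W) _.
have rem0 : 0 <= rem by apply: sumr_ge0 => z _; apply: mdist_ge0.
have eL0 : 0 < e * L by rewrite mulr_gt0.
(* Besides the root and the vertices that are not unary, [B] holds both ends of every long edge, so
   that zones contain short edges only. *)
pose B := [set x in W | (x == r) || (#|kids par r W x| != 1%N)] :|: Lg :|: par @: Lg.
have BW : B \subset W.
  apply/subsetP => x; rewrite !inE => /orP[/orP[/andP[]//|/andP[]//]|].
  by case/imsetP => y; rewrite inE => /andP[yW _] ->; apply: pW.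
have subB x : x \in W -> x \notin B -> #|kids par r W x| = 1%N /\ x != r.
  move=> xW; rewrite !inE xW /= !negb_or negbK => /andP[/andP[/andP[xr /eqP c1] _] _].
  by [].
have short x : x \in W -> x != r -> x \notin B \/ par x \notin B ->
    mdist x (par x) < a / 2.
  move=> xW xr H; rewrite ltNge; apply/negP => xl.
  have xL : x \in Lg by rewrite inE xW xr xl.
  have pB : par x \in B by rewrite in_setU imset_f ?orbT.
  by case: H; rewrite ?pB // in_setU [x \in _ :|: Lg]in_setU xL !orbT.
pose E := missing G N L e.
(* A missing link has length between [L] and [8 * L], so the surplus [e * mdist u v] is at least
   [e * L], and [9 * L <= a] with [e <= 1] gives the other bound. *)
have E_link u v : E u v -> [/\ u \in N, v \in N, u != v,
    mdist u v + e * L <= a & forall c, reach G u v c -> mdist u v + e * L <= c].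
  move=> /and5P[uN vN Ld dL /asboolP nr]; split => //.
  - by rewrite -mdist_gt0; lra.
  - by have := ler_piMl (ltW L0) e1; lra.
  - move=> c rc; rewrite leNgt; apply/negP => lt; apply: nr.
    apply: reach_sub rc => //; rewrite mulrDl mul1r.
    by have := ler_wpM2l (ltW e0) Ld; lra.
have sumE (P : seq (X * X)) : \sum_(p <- P) (mdist p.1 p.2 + e * L) =
    \sum_(p <- P) mdist p.1 p.2 + (size P)%:R * (e * L).
  by rewrite big_split /= big_const_seq count_predT iter_addr_0 mulr_natl.
(* The accounting shared by the two cases below: each link of [P] lowers the weight by at least
   [e * L], so [size P] is at most the loss divided by [e * L]. *)
have finish (P : seq (X * X)) (A : {set X}) :
  (forall p, p \in P -> link_ok par h W B a G (e * L) p /\ E p.1 p.2) ->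
  pairwise (fun p p' =>
    [disjoint zone2 par h r W a p & zone2 par h r W a p']) P ->
  uniq P -> (forall u v, E u v -> u \in A \/ v \in A) ->
  #|A|%:R <= 8 / s * rem + 8 * M%:R * #|Lg|%:R + 12 * M%:R * (size P)%:R ->
  exists (A V' : {set X}) (F' : rel X),
  [/\ forall u v, missing G N L e u v -> u \in A \/ v \in A,
      [/\ symmetric F', irreflexive F' &
          forall x y, F' x y -> G x y || missing G N L e x y],
      [/\ V' != set0, {in V' &, forall x y, connect F' x y} & covered a W V'],
      weight F' <= \sum_(x in W :\ r) mdist x (par x) &
      #|A|%:R <= 8 / s * rem + 8 * M%:R * #|Lg|%:R + 12 * M%:R / (e * L) *
          (\sum_(x in W :\ r) mdist x (par x) - weight F')].
  move=> okP dP uP cA bA.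
  have [D [Z [DP ZP PW conn gain]]] :=
    surgery_exists pr hE rW pW tW subB s0 M0 aE sG tG (fun p pP => proj1 (okP p pP)) dP.
  have DW : D \subset W :\ r.
    apply/subsetP => z /DP[p _]; rewrite !inE.
    by move=> /orP[] /and3P[-> -> _].
  have wF := weight_cut_graph par uP DW.
  have rZ : r \notin Z.
    by apply/negP => /ZP[p _ /andP[]]; rewrite !inE eqxx !andbF.
  rewrite sumE in gain.
  set F' := cut_graph par r W D P in wF conn.
  have F'S : connect_sym F' by apply: cut_connect_sym.
  (* A deleted vertex lies within [a] of an end of a link of [P], and these ends survive. *)
  exists A, (W :\: Z), F'; split => //.
  - split; first exact: cut_graph_sym.
      move=> x; rewrite /F' /cut_graph orbb.
      have pN : [&& x \in W, x != r, x \notin D & x == par x] = false.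
        apply/negP => /and4P[xW xr _ xp].
        by have := par_neq tW xW xr; rewrite eq_sym xp.
      rewrite pN /=; apply/negP => xP.
      by have [_ /E_link[_ _]] := okP _ xP; rewrite eqxx.
    move=> x y /or4P[/and4P[xW xr _ /eqP ->]|/and4P[yW yr _ /eqP ->]|xyP|xyP].
    + by rewrite tG.
    + by rewrite sG tG.
    + by have [_] := okP _ xyP; rewrite /E /= => ->; rewrite orbT.
    + by have [_] := okP _ xyP; rewrite /E /= missing_sym // => ->; rewrite orbT.
  - split.
    + by apply/set0Pn; exists r; rewrite inE rZ.
    + move=> x y; rewrite !inE => /andP[xZ xW] /andP[yZ yW].
      apply: connect_trans (conn _ xW xZ) _; rewrite F'S; exact: conn.
    + move=> x xW; have [xZ|xZ] := boolP (x \in Z); last first.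
        by exists x; rewrite ?inE ?xZ // mdistxx ltW.
      have [p pP /andP[_ /ltW d]] := ZP _ xZ; exists p.1 => //.
      by have [p1 p2] := PW _ pP; rewrite inE p1 p2.
  - have H : 0 <= (size P)%:R * (e * L) by rewrite mulr_ge0 // ltW.
    lra.
  - apply: le_trans bA _; rewrite lerD2l; set c := 12 * M%:R.
    have c0 : 0 <= c by apply: mulr_ge0.
    rewrite -mulrA; apply: ler_wpM2l => //.
    by rewrite mulrC ler_pdivlMr //; lra.
(* In a one-vertex tree the root is a leaf with no pruned branch to charge, but then there is no
   link either. *)
have [WE|Wr] := eqVneq W [set r].
  apply: (finish [::] set0) => // [u v /E_link[uN vN uv _ _]|].
    have := subsetP NW _ uN; have := subsetP NW _ vN.
    by rewrite WE => /set1P vr /set1P ur; rewrite ur vr eqxx in uv.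
  rewrite cards0 mulr0 addr0; apply: addr_ge0; first by rewrite mulr_ge0 // divr_ge0 // ltW.
  by apply: mulr_ge0 => //; apply: mulr_ge0.
have [P [A [okP dP uP cA bA]]] :=
  link_family pr hE pW tW subB s0 M0 aE BW short NW sepN E_link.
apply: (finish P A) => //.
pose Lf := [set x in W | #|kids par r W x| == 0%N].
have rk : #|kids par r W r| != 0%N.
  have [x xW xr] : exists2 x, x \in W & x != r.
    apply/exists_inP; apply: contraNT Wr; rewrite negb_exists => /forallP H.
    rewrite eqEsubset sub1set rW andbT; apply/subsetP => x xW.
    by have := H x; rewrite xW /= negbK inE.
  have rx : r != x by rewrite eq_sym.
  have [k kk _] := kids_toward pr pW (tW _ xW) rx xW.
  by rewrite cards_eq0; apply/set0Pn; exists k.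
(* The strict inequality of [card_branching] absorbs the root. *)
have c1 : (#|B| <= 2 * #|Lf| + 2 * #|Lg|)%N.
  apply: leq_trans (leq_card_setU _ _) _; rewrite [(2 * #|Lg|)%N]mul2n -addnn addnA.
  apply: leq_add; last exact: leq_imset_card.
  apply: leq_trans (leq_card_setU _ _) _; apply: leq_add => //.
  apply: leq_trans (card_branching rW pW).
  set S := [set x in W | _ != _]; have := cardsU1 r S => cS.
  apply: (@leq_trans #|r |: S|); last by rewrite cS -addn1 addnC leq_add2l leq_b1.
  apply/subset_leq_card/subsetP => x; rewrite !inE => /andP[xW].
  by rewrite xW.
have c2 : #|Lf :\: Lg|%:R * (a / 2) <= rem.
  apply: (prune_leaves pr hE pW UE WU) => x; rewrite !inE.
  move=> /andP[xL /andP[xW /eqP k0]]; split => //.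
  have xr : x != r by apply: contraNneq rk => xE; rewrite -{2}xE; apply/eqP.
  by apply: leafP => //; move: xL; rewrite xW xr /= -ltNge.
have c3 : (#|Lf| <= #|Lf :\: Lg| + #|Lg|)%N.
  by rewrite -(cardsID Lg Lf) addnC leq_add2l subset_leq_card // subsetIr.
have M1 : 0 < M%:R :> R by rewrite ltr0n.
have c4 : #|Lf :\: Lg|%:R * M%:R <= 2 / s * rem.
  rewrite mulrAC ler_pdivlMr //; rewrite aE in c2; move: c2.
  set t := #|_|%:R; set m := M%:R; lra.
have N1 : (#|A| <= 4 * (#|Lf :\: Lg| * M) + 8 * (M * #|Lg|) + 12 * (M * size P))%N.
  by move: bA c1 c3; clear; move: #|A| #|B| #|Lf| #|Lg| #|_| (size P) => *; nia.
rewrite -(ler_nat R) !natrD !natrM in N1; apply: le_trans N1 _.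
by move: c4; set t := #|_ :\: _|%:R; lra.
Qed.

End Reduction.

Section SpannerStep.
Context {R : realType} {X : finMetricType R}.
Implicit Types x y z u v : X.

(** [N1] is a net on the pruned tree, where the links are treated by [reduce_tree]; [N2] covers the
    rest and is put into [A] entirely, its size being paid by the pruned weight. This adds [2 / s]
    to the [8 / s] of [reduce_tree]. *)
Lemma spanner_step (G F : rel X) (V : {set X}) (s L e : R) (M : nat) :
  symmetric G -> symmetric F -> irreflexive F ->
  (forall x y, F x y -> G x y) ->
  V != set0 -> {in V &, forall x y, connect F x y} ->
  0 < s -> (0 < M)%N -> 0 < L -> 9 * L <= s * M%:R -> 0 < e -> e <= 1 ->
  exists (N1 N2 A V' : {set X}) (F' : rel X),
  [/\ separated s N1, separated s N2 & covered (2 * s) V (N1 :|: N2)] /\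
  [/\ forall u v, missing G (N1 :|: N2) L e u v -> u \in A \/ v \in A,
      [/\ symmetric F', irreflexive F' &
          forall x y, F' x y -> G x y || missing G (N1 :|: N2) L e x y],
      [/\ V' != set0, {in V' &, forall x y, connect F' x y} &
          covered (2 * (s * M%:R)) V V'],
      weight F' <= weight F &
      #|A|%:R <= (10 / s + 12 * M%:R / (e * L)) * (weight F - weight F') +
        8 * M%:R *
        #|[set p : X * X | F p.1 p.2 && (s * M%:R / 2 <= mdist p.1 p.2)]|%:R].
Proof.
move=> sG sF iF FG /set0Pn[r rV] cV s0 M0 L0 La e0 e1.
set a := s * M%:R; have a0 : 0 < a by rewrite /a; lra.
have eL0 : 0 < e * L by rewrite mulr_gt0.
have [par [h [pr hE ctree tF]]] := rooted_spanning_tree r sF.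
pose U := [set x | anc par r x].
have UE x : x \in U = anc par r x by rewrite inE.
have VU x : x \in V -> x \in U by move=> xV; rewrite UE; apply/ctree/cV.
(* The depth of the branch is measured from [par x]: discarded vertices then stay within [a] of [W],
   and a leaf keeps a pruned branch of length at least [a] minus its own edge. *)
pose W := [set x in U | (x == r) ||
  [exists y, anc par x y && (a <= h y - h (par x))]].
have WU : W \subset U by apply/subsetP => x; rewrite inE => /andP[].
have tW x : x \in W -> anc par r x by move/(subsetP WU); rewrite UE.
have rW : r \in W by rewrite inE UE anc_refl eqxx.
have pW x : x \in W -> par x \in W.
  rewrite !inE => /andP[rx H]; have [->|xr] := eqVneq x r.
    by rewrite pr eqxx anc_refl.
  rewrite (negPf xr) /= in H; case/existsP: H => y /andP[xy hy].
  rewrite (anc_in_tree pr (anc_par par x) rx) /=; apply/orP; right.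
  apply/existsP; exists y; rewrite (anc_trans (anc_par par x) xy) /=.
  by have := anc_height hE (anc_par par (par x)); lra.
have tG x : x \in W -> x != r -> G x (par x).
  by move=> /tW rx xr; apply/FG/tF.
have low x : x \in U -> exists w, [/\ w \in W, anc par w x & h x - h w < a].
  move=> xU; have P0 : [pred w in W | anc par w x] r by rewrite /= rW -UE.
  case: (arg_maxP h P0) => w /= /andP[wW wx] wmax; exists w; split => //.
  have [->|wNx] := eqVneq w x; first by rewrite subrr.
  have [y [yx py yw]] := anc_child wx wNx.
  have wy : anc par w y by rewrite -py; apply: anc_par.
  have yW : y \notin W.
    apply/negP => yW; have := wmax y; rewrite /= yW yx => /(_ isT).
    by rewrite leNgt (anc_height_lt hE wy) // eq_sym.
  move: yW; rewrite inE UE (anc_in_tree pr yx) -?UE //= negb_or.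
  move=> /andP[_ /existsPn/(_ x)]; rewrite yx /= py; lra.
have [N1 [N1W sep1 cov1]] := maximal_separated W s0.
(* Points less than [s] below [W] are within [2 * s] of [N1]; [T2] holds the others. *)
pose T2 := [set y in U | [forall z in W, anc par z y ==> (s <= h y - h z)]].
have [N2 [N2T sep2 cov2]] := maximal_separated T2 s0.
set rem := \sum_(z in U :\: W) mdist z (par z).
have leafP x : x \in W -> #|kids par r W x| = 0%N -> x != r ->
     mdist x (par x) < a / 2 ->
     exists y, [/\ y \in U, anc par x y & a / 2 <= h y - h x].
  move=> xW _ xr dx; move: (xW); rewrite inE (negPf xr) /= => /andP[xU].
  case/existsP => y /andP[xy hy]; exists y; split => //.
    by rewrite UE; apply: anc_trans xy; rewrite -UE.
  by have := hE x; lra.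
have [A [V' [F' [cA [sF' iF' F'G] [V0 cV' covV'] wF' bA]]]] :=
  reduce_tree pr hE rW pW tW UE WU sG tG s0 M0 (erefl _) L0 La e0 e1 N1W sep1 leafP.
rewrite -/a -/rem in bA.
have mono u v : missing G N1 L e u v -> missing G (N1 :|: N2) L e u v.
  by move=> /and5P[u1 v1 H1 H2 H3]; rewrite /missing !inE u1 v1 H1 H2 H3.
have wF : \sum_(x in W :\ r) mdist x (par x) + rem <= weight F.
  apply: le_trans (weight_ge_parents (U := U :\ r) (par := par) sF _ _).
  - rewrite [X in _ <= X](big_setID (W :\ r)) /=.
    have -> : (U :\ r) :&: (W :\ r) = W :\ r.
      by apply/setIidPr; apply: setSD.
    have -> // : (U :\ r) :\: (W :\ r) = U :\: W.
    apply/setP => x; rewrite !in_setD !in_set1.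
    by case: (eqVneq x r) => [->|] //=; rewrite rW.
  - by move=> x; rewrite inE UE => /andP[xr rx]; apply: tF => //; rewrite inE in xr.
  - move=> x; rewrite !inE => /andP[xr rx]; apply/eqP => ppx.
    have px : par x != x.
      apply/eqP => E; have := tF _ rx xr; by rewrite E iF.
    have := height_par hE px; have := anc_height hE (anc_par par (par x)).
    by rewrite ppx; lra.
have rem0 : 0 <= rem by apply: sumr_ge0 => z _; apply: mdist_ge0.
(* Each point of [N2] pays with the path of length at least [s / 2] above it. The path avoids [W],
   which is at least [s] above, and two such paths are disjoint because the points are [s] apart. *)
have c2 : #|N2|%:R <= 2 / s * rem.
  rewrite mulrAC ler_pdivlMr //.
  suff : #|N2|%:R * (s / 2) <= rem by lra.
  have T2P u z : u \in N2 -> z \in W -> anc par z u -> s <= h u - h z.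
    move=> /(subsetP N2T); rewrite inE => /andP[_ /forall_inP H] zW.
    by apply/implyP; apply: H.
  have N2U u : u \in N2 -> u \in U.
    by move=> /(subsetP N2T); rewrite inE => /andP[].
  have K u : exists z, u \in N2 -> [/\ anc par z u, s / 2 <= h u - h z &
      forall y, y \in seg par z u -> h u - h y < s / 2].
    have [uN|] := boolP (u \in N2); last by exists u.
    have ru : anc par r u by rewrite -UE N2U.
    have s2 : 0 < s / 2 by lra.
    have us : s / 2 <= h u - h r by have := T2P _ _ uN rW ru; lra.
    by have [z Hz] := first_above hE s2 ru us; exists z.
  have [zf Hz] := choice K.
  apply: (@le_trans _ _ (\sum_(u in N2) \sum_(z in seg par (zf u) u) mdist z (par z))).
    rewrite mulr_natl -sumr_const; apply: ler_sum => u uN.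
    by have [zu hz _] := Hz u uN; rewrite (seg_sum hE zu); lra.
  apply: disjoint_sum => [z|u uN|u v z uN vN zu zv]; first exact: mdist_ge0.
    have [zu hz hs] := Hz u uN; apply/subsetP => y ys.
    have := hs _ ys; move: ys; rewrite inE => /and3P[_ yu _] hy.
    rewrite inE UE (anc_in_tree pr yu) -?UE ?N2U // andbT.
    by apply/negP => yW; have := T2P _ _ uN yW yu; lra.
  apply/eqP/negPn/negP => uv; have := sep2 _ _ uN vN uv.
  have [_ _ /(_ _ zu) hu] := Hz u uN; have [_ _ /(_ _ zv) hv] := Hz v vN.
  move: zu zv; rewrite !inE => /and3P[_ zu _] /and3P[_ zv _].
  have := metric_triangle u z v; have := anc_dist hE zu; have := anc_dist hE zv.
  by rewrite (metric_sym z v); lra.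
exists N1, N2, (A :|: N2), V', F'; split; first split => //.
- move=> x /VU xU.
  case: (pickP [pred z in W | anc par z x && (h x - h z < s)]) => [z|H].
    move=> /and3P[zW zx hz]; have [y yN yz] := cov1 _ zW.
    exists y; first by rewrite inE yN.
    have := metric_triangle x z y; have := anc_dist hE zx; lra.
  have xT : x \in T2.
    rewrite inE xU; apply/forall_inP => z zW; apply/implyP => zx.
    by have := H z; rewrite /= zW zx /= leNgt => ->.
  have [y yN yx] := cov2 _ xT; exists y; first by rewrite inE yN orbT.
  lra.
- split => //.
  + move=> u v /and5P[]; rewrite !in_setU => /orP[uN|->]; last by rewrite orbT; left.
    move=> /orP[vN|->]; last by rewrite orbT; right.
    move=> H1 H2 H3; have : missing G N1 L e u v by rewrite /missing uN vN H1 H2 H3.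
    by move=> /cA[] ->; [left|right].
  + split => // x y /F'G /orP[->//|/mono ->]; by rewrite orbT.
  + split => // x /VU/low[w [wW wx hw]]; have [y yV wy] := covV' _ wW.
    exists y => //; have := metric_triangle x w y; have := anc_dist hE wx; rewrite -/a in wy; lra.
  + lra.
  + have cL : (#|[set x in W | (x != r) && (a / 2 <= mdist x (par x))%R]| <=
      #|[set p : X * X | F p.1 p.2 && (a / 2 <= mdist p.1 p.2)%R]|)%N.

      rewrite -(card_imset _ (f := fun x => (x, par x))); last by move=> x y [].
      apply/subset_leq_card/subsetP => p /imsetP[x]; rewrite inE.
      by move=> /and3P[/tW rx xr dx] ->; rewrite inE /= dx tF.
    rewrite -(ler_nat R) in cL.
    have cU : (#|A :|: N2| <= #|A| + #|N2|)%N by exact: leq_card_setU.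
    rewrite -(ler_nat R) natrD in cU; apply: le_trans cU _.
    have k1 : 0 <= 10 / s by rewrite divr_ge0 // ltW.
    have k2 : 0 <= 12 * M%:R / (e * L) by rewrite divr_ge0 // ?mulr_ge0 // ltW.
    have M1 : 0 <= 8 * M%:R :> R by rewrite mulr_ge0.
    have q1 := ler_wpM2l M1 cL.
    set W1 := \sum_(x in W :\ r) _ in wF bA wF'.
    have q2 : 10 / s * rem <= 10 / s * (weight F - weight F').
      by apply: ler_wpM2l => //; lra.
    have q3 : 12 * M%:R / (e * L) * (W1 - weight F') <=
              12 * M%:R / (e * L) * (weight F - weight F').
      by apply: ler_wpM2l => //; lra.
    have q4 : 10 / s * rem = 8 / s * rem + 2 / s * rem by rewrite -!mulrDl; congr (_ * _ * _); ring.
    rewrite [(10 / s + _) * _]mulrDl; lra.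
Qed.

End SpannerStep.

(** * Iterating over the scales of a class *)

Section Scales.
Context {R : realType} {X : finMetricType R}.
Variables (T : rel X) (sg e q D : R) (M : nat).
Hypothesis symT : symmetric T.
Hypothesis irrT : irreflexive T.
Hypothesis connT : forall x y, connect T x y.
Hypothesis X_gt0 : (0 < #|X|)%N.
Hypothesis sg_gt0 : 0 < sg.
Hypothesis M_gt0 : (0 < M)%N.
Hypothesis sgM : 9 <= sg * M%:R.
Hypothesis e_gt0 : 0 < e.
Hypothesis e_le1 : e <= 1.
Hypothesis q_ge2 : 2 <= q.
Hypothesis D_ge0 : 0 <= D.
Hypothesis packing : forall (L : R) (N : {set X}) u, 0 < L ->
  separated (sg * L) N -> #|[set v in N | mdist u v <= 8 * L]|%:R <= D.
Implicit Types x y z u v : X.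

Let al := sg * M%:R.
(** The price of a unit of potential. A vertex of [A] costs [16 * D * L] in links; lost weight of
    [F] enters with [10 / sg] and lost excess with 8M times 4/al, that is [32 / sg], which
    dominates. *)
Let K := 16 * D * (32 / sg + 12 * M%:R / e).

Let K_ge0 : 0 <= K.
Proof.
rewrite /K; apply: mulr_ge0; first exact: mulr_ge0.
by apply: addr_ge0; apply: divr_ge0 => //; rewrite ?mulr_ge0 // ltW.
Qed.

(* This potential pays for the long edges of T met at each scale. *)
Definition excess (t : R) : R :=
  \sum_(p : X * X | T p.1 p.2) Num.max (mdist p.1 p.2 - t) 0.

(** An edge of length at least [t'] loses exactly [t' - t], which is at least [t' / 2]. *)
Lemma excess_drop t t' : 0 <= t -> 2 * t <= t' ->
  t' / 2 * #|[set p : X * X | T p.1 p.2 && (t' <= mdist p.1 p.2)]|%:R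
    <= excess t - excess t'.
Proof.
move=> t0 tt; rewrite /excess -sumrB -sum1_card natr_sum mulr_sumr.
rewrite big_mkcond [X in _ <= X]big_mkcond /=; apply: ler_sum => p _.
rewrite inE; case: (T p.1 p.2) => //=.
set d := mdist _ _; rewrite /Num.max; case: (leP t' d) => H; rewrite ?mulr1;
  by case: ltP => ?; case: ltP => ?; lra.
Qed.

Lemma excess0_le t : 0 <= t -> excess t <= 2 * weight T.
Proof.
move=> t0; rewrite weightE mulrC divfK //; apply: ler_sum => p _.
rewrite ge_max mdist_ge0 andbT; lra.
Qed.

(** Orient each link away from an end in [A]: such an end has at most [D] neighbours in either net,
    each at distance at most [8 * L]. *)
Lemma weight_missing (G : rel X) (N1 N2 A : {set X}) (L : R) :
  symmetric G -> 0 < L -> separated (sg * L) N1 -> separated (sg * L) N2 ->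
  (forall u v, missing G (N1 :|: N2) L e u v -> u \in A \/ v \in A) ->
  weight (missing G (N1 :|: N2) L e) <= 16 * D * L * #|A|%:R.
Proof.
move=> sG L0 s1 s2 cA; set E := missing _ _ _ _.
pose Dd : rel X := fun x y => (x \in A) && E x y.
apply: le_trans (weight_le_directed (D := Dd) _) _.
  move=> x y Exy; rewrite /Dd; have Eyx : E y x by rewrite /E missing_sym.
  by rewrite Exy Eyx !andbT; apply/orP; exact: cA.
rewrite -(pair_big_dep (mem A) E (fun x y => mdist x y)) /=.
rewrite mulr_natr -sumr_const; apply: ler_sum => x _.
apply: (@le_trans _ _ (\sum_(y | E x y) 8 * L)).
  by apply: ler_sum => y /and5P[].
rewrite (_ : \sum_(y | E x y) 8 * L = 8 * L * #|E x|%:R); last first.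
  by rewrite [RHS]mulr_natr -sumr_const.
have c : (#|E x| <= #|[set v in N1 | (mdist x v <= 8 * L)%R]| +
                    #|[set v in N2 | (mdist x v <= 8 * L)%R]|)%N.
  apply: leq_trans (leq_of_leqif (leq_card_setU _ _)).
  apply/subset_leq_card/subsetP => y /and5P[_ yN _ dy _].
  by move: yN; rewrite !inE dy !andbT.
rewrite -(ler_nat R) natrD in c.
have c' : #|E x|%:R <= 2 * D.
  apply: le_trans c _; have -> : 2 * D = D + D by ring.
  exact: lerD (packing x L0 s1) (packing x L0 s2).
have L8 : 0 <= 8 * L by lra.
apply: le_trans (ler_wpM2l L8 c') _; by rewrite le_eqVlt; apply/orP; left; apply/eqP; ring.
Qed.

(** The invariant before scale [L] is treated. The covering radius stays bounded because the radii
    form a geometric series of ratio [q >= 2]; the fourth clause makes the edges of [F] that are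
    long at this scale edges of [T]; the last one starts from the budget
    [weight F + excess <= 3 * weight T]. *)
Definition scale_state (L : R) (G F : rel X) (V : {set X}) : Prop :=
  [/\ [/\ symmetric G, irreflexive G & forall x y, T x y -> G x y],
      [/\ symmetric F, irreflexive F & forall x y, F x y -> G x y],
      [/\ V != set0, {in V &, forall x y, connect F x y} &
          covered (4 * (al * L) / q) [set: X] V],
      forall x y, G x y -> T x y \/ mdist x y < al * L / 2 &
      weight G + K * (weight F + excess (al * L / (2 * q)))
        <= (1 + 3 * K) * weight T].

Lemma scale_step L G F V : 0 < L -> scale_state L G F V ->
  exists (G' F' : rel X) (V' N : {set X}),
  [/\ scale_state (q * L) G' F' V', forall x y, G x y -> G' x y,
      covered ((4 * al / q + 2 * sg) * L) [set: X] N &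
      forall u v, u \in N -> v \in N -> L <= mdist u v -> mdist u v <= 8 * L ->
        reach G' u v ((1 + e) * mdist u v)].
Proof.
move=> L0 [[sG iG TG] [sF iF FG] [V0 cV covV] lG wG].
have al9 : 9 <= al by exact: sgM.
have s0 : 0 < sg * L by rewrite mulr_gt0.
have aE : sg * L * M%:R = al * L by rewrite /al mulrAC.
have aL : 9 * L <= al * L by rewrite ler_wpM2r // ltW.
have aL' : 9 * L <= sg * L * M%:R by rewrite aE.
have q0 : 0 < q by apply: lt_le_trans q_ge2; rewrite ltr0n.
have al0 : 0 < al * L by apply: lt_le_trans aL; rewrite mulr_gt0.
have [N1 [N2 [A [V' [F' [[sep1 sep2 covN] [cA [sF' iF' F'G] [V'0 cV' covV'] wF bA]]]]]]] :=
  spanner_step sG sF iF FG V0 cV s0 M_gt0 L0 aL' e_gt0 e_le1.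
rewrite aE in covV' bA.
set N := N1 :|: N2 in covN cA F'G.
set E := missing G N L e in cA F'G.
have sE : symmetric E by exact: missing_sym.
pose G' : rel X := fun x y => G x y || E x y.
exists G', F', V', N; split.
- split.
  + split; [|move=> x|by move=> x y /TG H; rewrite /G' H].
      by move=> x y; rewrite /G' sG sE.
    rewrite /G' iG /=; apply/negP => /and5P[_ _ H _ _]; rewrite mdistxx in H; lra.
  + by split.
  + split => // x _; have [y yV xy] := covV x (in_setT x).
    have [z zV yz] := covV' _ yV; exists z => //.
    have -> : 4 * (al * (q * L)) / q = 4 * (al * L).
      by field; rewrite gt_eqF.
    have : 4 * (al * L) / q <= 2 * (al * L).
      by rewrite ler_pdivrMr //; have := ler_wpM2l (ltW al0) q_ge2; lra.
    by have := metric_triangle x y z; lra.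
  + have qL : 2 * (al * L) <= al * (q * L).
      by have := ler_wpM2l (ltW al0) q_ge2; lra.
    move=> x y /orP[/lG[->|H]|/and5P[_ _ _ H _]]; [by left|right; lra|right; lra].
  + have Eg : al * (q * L) / (2 * q) = al * L / 2 by field; rewrite gt_eqF.
    have drop := @excess_drop (al * L / (2 * q)) (al * L / 2) _ _.
    have t0 : 0 <= al * L / (2 * q) by rewrite divr_ge0 // ?mulr_ge0 // ltW.
    have tt : 2 * (al * L / (2 * q)) <= al * L / 2.
      rewrite (_ : 2 * _ = al * L / q); last by field; rewrite gt_eqF.
      by rewrite ler_pdivrMr //; have := ler_wpM2l (ltW al0) q_ge2; lra.
    have {t0 tt}drop := drop t0 tt; rewrite Eg.
    set x0 := excess _ in wG drop *; set x1 := excess _ in drop *.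
    have wE : weight E <= 16 * D * L * #|A|%:R by apply: weight_missing.
    have wG' : weight G' <= weight G + weight E by apply: weight_subadd.
    set lam := #|[set p : X * X | F p.1 p.2 && _]| in bA.
    set lamT := #|_| in drop.
    (* Links added at earlier scales are too short to be counted, so the long edges of [F] are
       charged to the excess of [T]. *)
    have ll : lam%:R <= lamT%:R :> R.
      rewrite ler_nat; apply/subset_leq_card/subsetP => p; rewrite !inE.
      by move=> /andP[/FG/lG[->|H] H'] //=; move: H; rewrite ltNge H'.
    have drop' : lam%:R <= 4 / (al * L) * (x0 - x1).
      rewrite mulrAC ler_pdivlMr //; have := ler_wpM2l (ltW al0) ll; lra.
    have d1 : 0 <= x0 - x1.
      apply: le_trans drop; apply: mulr_ge0 => //; lra.
    have c1 : 16 * D * L * (8 * M%:R * lam%:R) <= 16 * D * (32 / sg) * (x0 - x1).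
      have k : 0 <= 16 * D * L * (8 * M%:R).
        by apply: mulr_ge0; apply: mulr_ge0 => //; [apply: mulr_ge0|apply: ltW].
      have := ler_wpM2l k drop'.
      have -> : 16 * D * L * (8 * M%:R) * (4 / (al * L) * (x0 - x1)) =
                16 * D * (32 / sg) * (x0 - x1).
        rewrite /al; field; rewrite (gt_eqF L0) (gt_eqF sg_gt0) /=.
        by rewrite pnatr_eq0 -lt0n.
      lra.
    have c2 : 16 * D * L * ((10 / (sg * L) + 12 * M%:R / (e * L)) * (weight F - weight F'))
        = 16 * D * (10 / sg + 12 * M%:R / e) * (weight F - weight F').
      by field; rewrite (gt_eqF L0) (gt_eqF sg_gt0) (gt_eqF e_gt0).
    have k3 : 0 <= 16 * D * L by apply: mulr_ge0; [apply: mulr_ge0|apply: ltW].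
    have c3 := ler_wpM2l k3 bA.
    rewrite mulrDr in c3.
    have D16 : 0 <= 16 * D by apply: mulr_ge0.
    have p1 : 0 <= 16 * D * (22 / sg) * (weight F - weight F').
      apply: mulr_ge0; last lra.
      by apply: mulr_ge0 => //; apply: divr_ge0 => //; apply: ltW.
    have p2 : 0 <= 16 * D * (12 * M%:R / e) * (x0 - x1).
      apply: mulr_ge0 => //.
      by apply: mulr_ge0 => //; apply: divr_ge0; [apply: mulr_ge0|apply: ltW].
    have KE : K = 16 * D * (10 / sg + 12 * M%:R / e) + 16 * D * (22 / sg).
      by rewrite /K; field; rewrite (gt_eqF sg_gt0) (gt_eqF e_gt0).
    have KE' : K = 16 * D * (32 / sg) + 16 * D * (12 * M%:R / e).
      by rewrite /K mulrDr.
    have f1 : 16 * D * (10 / sg + 12 * M%:R / e) * (weight F - weight F') <=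
              K * (weight F - weight F') by rewrite KE mulrDl; lra.
    have f2 : 16 * D * (32 / sg) * (x0 - x1) <= K * (x0 - x1).
      by rewrite KE' mulrDl; lra.
    rewrite c2 in c3; move: wG wG' wE c1 c3 f1 f2; rewrite !mulrDr !mulrN.
    clear; lra.
- by move=> x y H; rewrite /G' H.
- move=> x _; have [y yV xy] := covV x (in_setT x).
  have [z zN yz] := covN _ yV; exists z => //; have := metric_triangle x y z.
  have -> : (4 * al / q + 2 * sg) * L = 4 * (al * L) / q + 2 * (sg * L).
    by field; rewrite gt_eqF.
  lra.
- move=> u v uN vN H1 H2; case: (boolP (E u v)) => Euv.
    apply: reach_edge; first by rewrite /G' Euv orbT.
    by rewrite ler_peMl ?mdist_ge0 // lerDl ltW.
  move: Euv; rewrite /E /missing uN vN H1 H2 /= negbK => /asboolP.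
  by apply: reach_sub => // x y H; rewrite /G' H.
Qed.

Lemma class_spanner (L : R) (n : nat) : 0 < L ->
  exists (G : rel X) (N : nat -> {set X}),
  [/\ [/\ symmetric G, irreflexive G & forall x y, T x y -> G x y],
      forall i, (i < n)%N ->
        covered ((4 * al / q + 2 * sg) * (L * q ^+ i)) [set: X] (N i) /\
        forall u v, u \in N i -> v \in N i ->
          L * q ^+ i <= mdist u v -> mdist u v <= 8 * (L * q ^+ i) ->
          reach G u v ((1 + e) * mdist u v) &
      weight G <= (1 + 3 * K) * weight T].
Proof.
move=> L0; have q0 : 0 < q by apply: lt_le_trans q_ge2; rewrite ltr0n.
have al0 : 0 < al by rewrite mulr_gt0 ?ltr0n.
have H : exists (G F : rel X) (V : {set X}) (N : nat -> {set X}),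
  scale_state (L * q ^+ n) G F V /\
  forall i, (i < n)%N ->
        covered ((4 * al / q + 2 * sg) * (L * q ^+ i)) [set: X] (N i) /\
        forall u v, u \in N i -> v \in N i ->
          L * q ^+ i <= mdist u v -> mdist u v <= 8 * (L * q ^+ i) ->
          reach G u v ((1 + e) * mdist u v).
  elim: n => [|n [G [F [V [N [st HN]]]]]].
    exists T, T, [set: X], (fun _ => set0); split => //; rewrite expr0 mulr1.
    split => //.
    - split => //; first by rewrite -card_gt0 cardsT.
      move=> x _; exists x => //; rewrite mdistxx.
      by rewrite divr_ge0 // ?mulr_ge0 // ltW.
    - by move=> x y; left.
    - have : excess (al * L / (2 * q)) <= 2 * weight T.
        by apply: excess0_le; rewrite divr_ge0 // ?mulr_ge0 // ltW.
      by move=> /(ler_wpM2l K_ge0); lra.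
  have Ln : 0 < L * q ^+ n by rewrite mulr_gt0 ?exprn_gt0.
  have [G' [F' [V' [N' [st' GG' cov HN']]]]] := scale_step Ln st.
  exists G', F', V', (fun i => if i == n then N' else N i); split.
    by rewrite exprS mulrCA.
  move=> i; rewrite ltnS leq_eqVlt => /orP[/eqP ->|lt].
    by rewrite eqxx; split.
  rewrite (ltn_eqF lt); have [c r] := HN i lt; split => // u v uN vN H1 H2.
  exact: reach_sub (r u v uN vN H1 H2).
have [G [F [V [N [[[sG iG TG] _ _ _ wG] HN]]]]] := H.
exists G, N; split => //; apply: le_trans wG; rewrite lerDl; apply: mulr_ge0 => //.
apply: addr_ge0; first exact: weight_ge0.
by apply: sumr_ge0 => p _; rewrite le_max lexx orbT.
Qed.

End Scales.

(** * Packing, spanning trees and the union of the classes *)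

Section Packing.
Context {R : realType} {X : finMetricType R}.
Implicit Types x y z u v : X.

Lemma doubling_iter (d : R) (k : nat) x (r : R) : doubling X d -> 0 < r ->
  exists2 C : {set X}, (#|C| <= Num.truncn (2 `^ d) ^ k)%N &
    forall y, mdist x y < r -> exists2 c, c \in C & mdist c y < r / 2 ^+ k.
Proof.
move=> dX r0; set n := Num.truncn _.
have dbl c t : 0 < t -> exists C : {set X}, (#|C| <= n)%N /\
    forall y, mdist c y < t -> exists2 c', c' \in C & mdist c' y < t / 2.
  move=> t0; have [C cC HC] := dX c t t0; exists C; split.
    rewrite /n -(ler_nat R) in cC *; rewrite ler_nat.
    by rewrite Num.Theory.truncn_ge_nat // powR_ge0.
  move=> y ct; have : ball c t y by rewrite ballEmdist.
  by move=> /HC[c' /= c'C]; rewrite ballEmdist /= => H; exists c'.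
elim: k => [|k [C cC HC]].
  exists [set x]; first by rewrite cards1.
  by move=> y xy; exists x; rewrite ?set11 // expr0 divr1.
have rk : 0 < r / 2 ^+ k by rewrite divr_gt0 // exprn_gt0.
have [Cf Hf] := choice (fun c => dbl c _ rk).
exists [set y | [exists c in C, y \in Cf c]].
  rewrite expnSr; apply: leq_trans (leq_mul cC (leqnn n)).
  apply: (@card_cover_le _ _ _ _ Cf) => [c _|y]; first by have [] := Hf c.
  by rewrite inE => /exists_inP.
move=> y /HC[c cC' cy]; have [_ /(_ _ cy)[c' c'C c'y]] := Hf c.
exists c'; first by rewrite inE; apply/exists_inP; exists c.
by rewrite exprSr invfM mulrA.
Qed.

(** An open ball of radius [9 * L] contains the closed one of radius [8 * L]; after [k] halvings the
    covering balls have radius at most [s / 2] and hold at most one point of [N] each. *)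
Lemma doubling_packing (d s L : R) (k : nat) (N : {set X}) u : doubling X d ->
  0 < L -> 18 * L <= s * 2 ^+ k -> separated s N ->
  (#|[set v in N | (mdist u v <= 8 * L)%R]| <= Num.truncn (2 `^ d) ^ k)%N.
Proof.
move=> dX L0 sL sep; have r0 : 0 < 9 * L by lra.
have [C cC HC] := doubling_iter k u dX r0; apply: leq_trans cC.
rewrite -[leqRHS]muln1.
apply: (@card_cover_le _ _ _ _
  (fun c => [set v in N | (mdist c v < 9 * L / 2 ^+ k)%R])).
  move=> c _; apply/card_le1_eqP => v w.
  rewrite !inE => /andP[vN cv] /andP[wN cw]; apply/eqP/negPn/negP => vw; rewrite eq_sym in vw.
  have := sep _ _ vN wN vw; have := metric_triangle v c w.
  have : 9 * L / 2 ^+ k <= s / 2 by rewrite ler_pdivrMr ?exprn_gt0 //; lra.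
  by rewrite (metric_sym v c); lra.
move=> v; rewrite inE => /andP[vN uv].
have [|c cC cv] := HC v; first by lra.
by exists c; rewrite // inE vN.
Qed.

Lemma weight_exists (I : finType) (G : I -> rel X) :
  weight (fun x y => [exists i, G i x y]) <= \sum_i weight (G i).
Proof.
rewrite [X in _ <= X](eq_bigr (fun i =>
    (\sum_(p : X * X | G i p.1 p.2) mdist p.1 p.2) / 2)); last first.
  by move=> i _; rewrite weightE.
rewrite weightE -mulr_suml.
rewrite ler_pM2r ?invr_gt0 //.
rewrite [X in _ <= X](eq_bigr (fun i => \sum_(p : X * X)
    if G i p.1 p.2 then mdist p.1 p.2 else 0)); last first.
  by move=> i _; rewrite big_mkcond.
rewrite exchange_big big_mkcond /=.
apply: ler_sum => p _; have pos (i : I) :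
    0 <= (if G i p.1 p.2 then mdist p.1 p.2 else 0) :> R.
  by case: ifP; rewrite ?mdist_ge0.
case: existsP => [[i Gi]|_]; last by apply: sumr_ge0.
by rewrite (bigD1 i) //= Gi lerDl; apply: sumr_ge0.
Qed.

Lemma star_spanning_tree x0 :
  spanning_tree (fun x y => (x != y) && ((x == x0) || (y == x0))).
Proof.
split.
- split; first by move=> x y; rewrite eq_sym orbC.
  by move=> x; rewrite eqxx.
- move=> x y; apply: (@connect_trans _ _ x0).
    have [->|xx] := eqVneq x x0; first exact: connect0.
    by apply: connect1; rewrite xx eqxx orbT.
  have [->|xx] := eqVneq y x0; first exact: connect0.
  by apply: connect1; rewrite eq_sym xx eqxx.
(* Every edge contains [x0], whereas a cycle of length at least 3 has an edge avoiding any given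
   vertex. *)
- move=> [|a [|b [|c p]]] // /andP[/= /and3P[/andP[_ ab] /andP[_ bc] cp]].
  rewrite !inE !negb_or => /and3P[/and3P[nab nac ap] /andP[nbc bp] _].
  case/orP: ab => /eqP E.
    by case/orP: bc => /eqP E'; [rewrite E E' eqxx in nab|rewrite E E' eqxx in nac].
  case: p cp ap bp => [|f p] /= /andP[/andP[_ cf] _].
    by case/orP: cf => /eqP E' _ _; [rewrite E E' eqxx in nbc|rewrite E E' eqxx in nab].
  move=> _; rewrite inE negb_or => /andP[nbf _].
  by case/orP: cf => /eqP E'; [rewrite E E' eqxx in nbc|rewrite E E' eqxx in nbf].
Qed.

Lemma minimum_spanning_tree_exists x0 : exists T : rel X, minimum_spanning_tree T.
Proof.
(* Relations are encoded as finite functions so that the minimum is taken over a finite type. *)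
pose st (f : {ffun X * X -> bool}) := spanning_tree (fun x y => f (x, y)).
have ffunE' (e : rel X) : (fun x y => [ffun p => e p.1 p.2] (x, y)) = e.
  by apply/funext => x; apply/funext => y; rewrite ffunE.
pose f0 : {ffun X * X -> bool} :=
  [ffun p => (p.1 != p.2) && ((p.1 == x0) || (p.2 == x0))].
have P0 : [pred f | `[< st f >]] f0.
  apply/asboolP; rewrite /st /f0.
  rewrite (ffunE' (fun x y => (x != y) && ((x == x0) || (y == x0)))).
  exact: star_spanning_tree.
case: (arg_minP (fun f : {ffun X * X -> bool} => weight (fun x y => f (x, y))) P0).
move=> f /asboolP sf fmin; exists (fun x y => f (x, y)); split => // e' se'.
have P' : [pred f | `[< st f >]] [ffun p => e' p.1 p.2].
  by apply/asboolP; rewrite /st ffunE'.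
by have := fmin _ P'; rewrite ffunE'.
Qed.

Lemma min_distance : exists2 l : R, 0 < l & forall x y, x != y -> 2 * l <= mdist x y.
Proof.
case: (pickP [pred p : X * X | p.1 != p.2]) => [p0 /= P0|H].
  have [p /= pN pmin] := arg_minP (fun p : X * X => mdist p.1 p.2)
     (P := [pred p : X * X | p.1 != p.2]) P0.
  exists (mdist p.1 p.2 / 2); first by rewrite divr_gt0 // mdist_gt0.
  by move=> x y xy; have := pmin (x, y) xy; rewrite /=; lra.
by exists 1 => // x y xy; have := H (x, y); rewrite /= xy.
Qed.

Lemma max_distance (l : R) : 0 < l ->
  exists J, forall x y, mdist x y < 2 * l * 2 ^+ J.
Proof.
move=> l0; pose B := \sum_(p : X * X) mdist p.1 p.2.
exists (Num.truncn (B / (2 * l))).+1 => x y.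
have dB : mdist x y <= B.
  rewrite /B (bigD1 (x, y)) //= lerDl; apply: sumr_ge0 => p _; exact: mdist_ge0.
have l2 : 0 < 2 * l by lra.
rewrite -ltr_pdivrMl // mulrC; apply: (@le_lt_trans _ _ (B / (2 * l))).
  by rewrite ler_pM2r ?invr_gt0.
apply: lt_le_trans (truncnS_gt _) _; rewrite -natrX ler_nat.
exact/ltnW/ltn_expl.
Qed.

End Packing.

Section ClassUnion.
Context {R : realType} {X : finMetricType R}.
Implicit Types x y z u v : X.

(** Induction on the dyadic size of the distance: [x] and [y] are moved to net points [x'] and [y']
    of their scale, which a class joins well, and the two short moves are covered by the induction
    hypothesis. *)
Lemma class_union_spanner (eps l eta : R) (m J : nat)
    (G : 'I_m -> rel X) (N : 'I_m -> nat -> {set X}) :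
  0 < eps -> eps < 1 -> 0 < l -> (0 < m)%N -> 0 <= eta -> 8 * eta <= eps ->
  (forall x y, x != y -> 2 * l <= mdist x y) ->
  (forall x y, mdist x y < 2 * l * 2 ^+ J) ->
  (forall c, symmetric (G c)) ->
  (forall (c : 'I_m) i, (i < J)%N ->
     covered (eta * (l * 2 ^+ c * (2 ^+ m) ^+ i)) [set: X] (N c i) /\
     forall u v, u \in N c i -> v \in N c i ->
       l * 2 ^+ c * (2 ^+ m) ^+ i <= mdist u v ->
       mdist u v <= 8 * (l * 2 ^+ c * (2 ^+ m) ^+ i) ->
       reach (G c) u v ((1 + eps / 2) * mdist u v)) ->
  forall x y, reach (fun x y => [exists c, G c x y]) x y ((1 + eps) * mdist x y).
Proof.
move=> eps0 eps1 l0 m0 eta0 eta8 lmin lmax sG H x y.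
set S : rel X := fun x y => [exists c, G c x y].
have sS : symmetric S.
  by move=> a b; apply: eq_existsb => c; rewrite sG.
suff K j : forall x y, mdist x y < 2 * l * 2 ^+ j ->
    reach S x y ((1 + eps) * mdist x y) by apply: K (lmax x y).
elim: j {x y} => [|j IH] x y.
  rewrite expr0 mulr1 => xy; have [->|/lmin] := eqVneq x y; last by lra.
  by apply: reach_refl; rewrite mdistxx mulr0.
have [|le] := ltP (mdist x y) (2 * l * 2 ^+ j); first by move/IH.
move=> lt; set L := l * 2 ^+ j.
have L0 : 0 < L by rewrite mulr_gt0 ?exprn_gt0.
have le' : 2 * L <= mdist x y by rewrite /L mulrA.
have lt' : mdist x y < 4 * L by move: lt; rewrite exprS /L; lra.
have jJ : (j < J)%N.
  have l2 : 0 < 2 * l by lra.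
  by have := le_lt_trans le (lmax x y); rewrite ltr_pM2l // ltr_eXn2l // ltr1n.
(* Scale [j] is handled by class [j] modulo [m], at its step [j %/ m]. *)
pose c : 'I_m := Ordinal (ltn_pmod j m0).
have iJ : (j %/ m < J)%N by apply: leq_ltn_trans (leq_div _ _) jJ.
have LE : l * 2 ^+ c * (2 ^+ m) ^+ (j %/ m) = L.
  by rewrite -exprM -mulrA -exprD addnC mulnC -divn_eq.
have [cov r] := H c _ iJ; rewrite LE in cov r.
have [x' x'N xx'] := cov x (in_setT x); have [y' y'N yy'] := cov y (in_setT y).
have eL : 8 * (eta * L) <= eps * L by rewrite mulrA ler_wpM2r // ltW.
have eL0 : 0 <= eta * L by rewrite mulr_ge0 // ltW.
have eL1 : eps * L <= L by rewrite ler_piMl // ltW.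
have t1 := metric_triangle x x' y; have t2 := metric_triangle x' y' y.
have t3 := metric_triangle x' x y; have t4 := metric_triangle x' y y'.
have rx : reach S x x' ((1 + eps) * mdist x x').
  by apply: IH; rewrite -mulrA -/L; lra.
have ry : reach S y' y ((1 + eps) * mdist y' y).
  by apply: IH; rewrite -mulrA -/L metric_sym; lra.
have rxy : reach S x' y' ((1 + eps / 2) * mdist x' y').
  apply: (reach_sub (e := G c)) => //.
    by move=> a b Gab; apply/existsP; exists c.
  by apply: r => //; rewrite (metric_sym x' x) in t3; rewrite (metric_sym y' y) in t2; lra.
apply: reach_trans (reach_trans rx rxy (lexx _)) ry _.
rewrite (metric_sym x' x) in t3; rewrite (metric_sym y' y) in t2 *.
(* The moves cost [4 * (eta * L)] and lengthen the middle walk by at most [3 * (eta * L)]. The slack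
   [eps / 2 * mdist x y] is at least [eps * L], hence at least [8 * (eta * L)]. *)
have u1 : (1 + eps) * mdist x x' <= 2 * (eta * L).
  by apply: ler_pM => //; [lra|exact: mdist_ge0|lra].
have u2 : (1 + eps) * mdist y y' <= 2 * (eta * L).
  by apply: ler_pM => //; [lra|exact: mdist_ge0|lra].
have u3 : (1 + eps / 2) * mdist x' y' <= (1 + eps / 2) * (mdist x y + 2 * (eta * L)).
  by apply: ler_wpM2l; lra.
have u4 : eps * (eta * L) <= eta * L by rewrite ler_piMl // ltW.
have u5 : eps * (2 * L) <= eps * mdist x y by apply: ler_wpM2l => //; apply: ltW.
have u6 : (1 + eps / 2) * (mdist x y + 2 * (eta * L)) =
  mdist x y + eps * mdist x y / 2 + 2 * (eta * L) + eps * (eta * L) by field.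
rewrite u6 in u3; rewrite mulrDl mul1r [(1 + eps) * mdist x y]mulrDl mul1r.
move: u1 u2 u3 u4 u5 eL eL0; rewrite !mulrDl !mul1r.
lra.
Qed.

End ClassUnion.

(** * Choice of the parameters and the final estimate *)

Section Dyadic.
Context {R : realType}.

Lemma dyadic_scale (t : R) : 1 < t ->
  exists m, [/\ (0 < m)%N, t <= 2 ^+ m & 2 ^+ m <= 2 * t].
Proof.
move=> t1; have ex : exists m, t <= 2 ^+ m.
  exists (Num.truncn t).+1; apply/ltW/(lt_le_trans (truncnS_gt _)).
  by rewrite -natrX ler_nat; apply/ltnW/ltn_expl.
exists (ex_minn ex); case: ex_minnP => [[|m]] tm mmin.
  by rewrite expr0 in tm; lra.
split => //; rewrite exprS; have [|le] := leP t (2 ^+ m); last lra.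
by move/mmin; rewrite ltnn.
Qed.

(** Exchanging the exponents [d] and [m] turns [m] halvings into the factor of order [eps^-d]. *)
Lemma doubling_degree_le (d : R) (m : nat) (t : R) : 0 <= d -> 2 ^+ m <= t ->
  (Num.truncn (2 `^ d) ^ m)%:R <= t `^ d :> R.
Proof.
move=> d0 mt; rewrite natrX; apply: (@le_trans _ _ ((2 `^ d) ^+ m)).
  by apply: lerXn2r; rewrite ?nnegrE ?powR_ge0 // Num.Theory.truncn_le ?powR_ge0.
rewrite -powR_mulrn ?powR_ge0 // -powRrM mulrC powRrM powR_mulrn //.
apply: ge0_ler_powR => //; rewrite nnegrE ?exprn_ge0 //.
by apply: le_trans mt; rewrite exprn_ge0.
Qed.

(** [2 ^+ m] is the first power of 2 from 640/eps on, and [M] is just above 288/eps, where 288 = 9 *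
    32. Then [eps * M <= 289] and 4 * 289 / 32 < 640 / 16 give the bound [eps / 16] on the first
    summand of the covering radius. *)
Lemma scale_parameters (eps : R) : 0 < eps -> eps < 1 ->
  exists m M : nat, [/\ [/\ (0 < m)%N, (0 < M)%N & 2 <= 2 ^+ m :> R],
    2 ^+ m <= 1280 / eps, 9 <= eps / 32 * M%:R, M%:R <= 289 / eps &
    18 <= eps / 32 * 2 ^+ m /\
    8 * (4 * (eps / 32 * M%:R) / 2 ^+ m + 2 * (eps / 32)) <= eps].
Proof.
move=> eps0 eps1.
have ei : 1 < eps^-1 by rewrite invf_gt1.
have t1 : 1 < 640 / eps by lra.
have [m [m0 mge mle]] := dyadic_scale t1.
have := truncnS_gt (288 / eps); set M := (Num.truncn _).+1 => Mgt.
have Mle : M%:R <= 289 / eps.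
  have H : (Num.truncn (288 / eps))%:R <= 288 / eps.
    by rewrite Num.Theory.truncn_le; apply: divr_ge0 (ltW eps0); apply: ler0n.
  rewrite /M -natr1 (_ : 289 / eps = 288 / eps + eps^-1); last by ring.
  exact: lerD H (ltW ei).
have q0 : 0 < 2 ^+ m :> R by rewrite exprn_gt0.
have mge' : 640 <= 2 ^+ m * eps by rewrite -ler_pdivrMr.
have Mgt' : 288 < M%:R * eps by rewrite -ltr_pdivrMr.
have Mle' : M%:R * eps <= 289 by rewrite -ler_pdivlMr.
exists m, M; split; [split|..|split] => //.
- by move: mge; apply: le_trans; move: ei; clear; lra.
- by move: mle; clear; lra.
- by move: Mgt'; clear; lra.
- by move: mge'; clear; lra.
suff : 4 * (eps / 32 * M%:R) / 2 ^+ m <= eps / 16 by clear; lra.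
by rewrite ler_pdivrMr //; move: mge' Mle'; clear; lra.
Qed.

(* With the parameters of [scale_parameters]; 7960 = 1024 + 24 * 289. *)
Lemma lightness_bound (d eps C : R) (m M : nat) :
  1 <= d -> 0 < eps -> eps < 1 -> 1 < C ->
  2 ^+ m <= C / eps -> M%:R <= 289 / eps ->
  m%:R * (1 + 3 * (16 * (Num.truncn (2 `^ d) ^ m)%:R *
     (32 / (eps / 32) + 12 * M%:R / (eps / 2)))) <=
  (ln C + 1) / ln 2 * (1 + 3 * (16 * 7960 * C `^ d)) *
    (eps `^ (- (d + 2)) * (1 + ln eps^-1)).
Proof.
move=> d1 eps0 eps1 C1 mle Mle.
have C0 : 0 < C by apply: lt_trans C1.
have lnC : 0 < ln C by apply: ln_gt0.
have ln2 : 0 < ln 2 :> R by apply: ln_gt0; rewrite ltr1n.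
have ei : 1 < eps^-1 by rewrite invf_gt1.
have i0 : 0 <= eps^-1 by rewrite invr_ge0 ltW.
have lne : 0 < ln eps^-1 by apply: ln_gt0.
set n : R := (_ ^ m)%:R; have n0 : 0 <= n by apply: ler0n.
have epsd : eps `^ (- d) = (eps^-1) `^ d.
  by rewrite -powR_inv1 ?(ltW eps0) // -powRrM mulN1r.
have -> : eps `^ (- (d + 2)) = eps `^ (- d) * (eps^-1 * eps^-1).
  rewrite opprD powRD; last by rewrite (gt_eqF eps0) implybT.
  congr (_ * _); rewrite -[2]/(2%:R) powRN powR_mulrn ?(ltW eps0) //.
  by rewrite exprS expr1 invfM.
have degP : n <= C `^ d * eps `^ (- d).
  rewrite epsd -(powRM d (ltW C0) i0); apply: doubling_degree_le => //.
  by apply: le_trans d1.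
have v1 : 1 <= eps `^ (- d).
  by rewrite epsd; apply: le_trans (ltW ei) _; apply: le1r_powR => //; apply: ltW.
have sE : 32 / (eps / 32) + 12 * M%:R / (eps / 2) = 1024 * eps^-1 + 24 * (M%:R * eps^-1).
  by field; rewrite gt_eqF.
have Me0 : 0 <= M%:R * eps^-1 by rewrite mulr_ge0.
have b : 1024 * eps^-1 + 24 * (M%:R * eps^-1) <= 7960 * (eps^-1 * eps^-1).
  have h1 := ler_wpM2r i0 Mle.
  have h2 : eps^-1 <= eps^-1 * eps^-1 by rewrite ler_peMl // ltW.
  move: h1 h2; clear; lra.
(* The number of classes is at most the binary logarithm of [C / eps]; this is the factor suppressed
   in the notation of the theorem. *)
have mB : m%:R <= (ln C + 1) / ln 2 * (1 + ln eps^-1).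
  rewrite mulrAC ler_pdivlMr // mulrC mulr_natr -lnXn //.
  apply: (@le_trans _ _ (ln (C / eps))).
    by rewrite ler_ln // posrE ?exprn_gt0 // divr_gt0.
  rewrite lnM ?posrE ?invr_gt0 //.
  have := mulr_gt0 lnC lne; rewrite mulrDl !mulrDr !mulr1 !mul1r.
  move: lne lnC; set x := ln C; set y := ln _; set z := x * y; clear; lra.
have b0 : 0 <= 1024 * eps^-1 + 24 * (M%:R * eps^-1) by move: i0 Me0; clear; lra.
have KP := ler_pM n0 b0 degP b; rewrite sE.
have ee : 1 <= eps^-1 * eps^-1 by rewrite -[1]mulr1 ler_pM // ltW.
have P1 : 1 <= eps `^ (- d) * (eps^-1 * eps^-1) by rewrite -[1]mulr1 ler_pM.
have nb := mulr_ge0 n0 b0.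
move: KP P1 mB nb; set u := C `^ d; set v := eps `^ _; set w := eps^-1 * _.
set t := 1024 * _ + _ => KP P1 mB nb.
have K1 : 1 + 3 * (16 * n * t) <= (1 + 3 * (16 * 7960 * u)) * (v * w).
  have -> : (1 + 3 * (16 * 7960 * u)) * (v * w) = v * w + 3 * (16 * (u * v * (7960 * w))).
    by ring.
  by rewrite -[16 * n * t]mulrA; move: KP P1 nb; clear; lra.
have K0 : 0 <= 1 + 3 * (16 * n * t) by rewrite -[16 * n * t]mulrA; move: nb; clear; lra.
apply: le_trans (ler_pM (ler0n _ _) K0 mB K1) _.
by rewrite le_eqVlt; apply/orP; left; apply/eqP; ring.
Qed.

End Dyadic.

Theorem theorem5 (R : realType) (d : R) (hd : 1 <= d) :
  exists2 K : R, 0 < K &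
    forall eps : R, 0 < eps -> eps < 1 ->
    forall X : finMetricType R, doubling_dimension X d ->
    exists (S : rel X) (l : R),
      [/\ spanner (1 + eps) S,
          has_lightness S l &
          l <= K * (eps `^ (- (d + 2)) * (1 + ln (eps^-1)))].
Proof.
have d0 : 0 <= d by apply: le_trans hd.
have ln2 : 0 < ln 2 :> R by apply: ln_gt0; rewrite ltr1n.
have [C CE] : exists C : R, C = 1280 by exists 1280.
have C1 : 1 < C by rewrite CE ltr1n.
exists ((ln C + 1) / ln 2 * (1 + 3 * (16 * 7960 * C `^ d))).
  apply: mulr_gt0; first by rewrite divr_gt0 // addr_gt0 // ln_gt0.
  by have := powR_ge0 C d; set u := C `^ d; clear; lra.
move=> eps eps0 eps1 X [dX dmin].
have X0 : (0 < #|X|)%N.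
  (* In an empty space every real is a doubling exponent, so there is no smallest one. *)
  rewrite lt0n; apply/eqP => E; have /dmin : doubling X (d - 1).
    by move=> x; move: (card0_eq E x); rewrite inE.
  by clear; lra.
have [x0 _] := card_gt0P X0.
have [T mT] := minimum_spanning_tree_exists x0.
have [[[sT iT] cT aT] _] := mT.
have [l l0 lmin] := @min_distance R X.
have [J lmax] := @max_distance R X l l0.
have [m [M [[m0 M0 q2] mle sgM Mle [mge eta8]]]] := scale_parameters eps0 eps1.
(* The same [m] gives the ratio [2 ^+ m] of the scales in a class, the number of classes, and the
   number of halvings in the packing bound. *)
pose n := (Num.truncn (2 `^ d) ^ m)%N.
have sg0 : 0 < eps / 32 by rewrite divr_gt0.
have e0 : 0 < eps / 2 by rewrite divr_gt0.
have e1 : eps / 2 <= 1 by move: eps1; clear; lra.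
have n0 : 0 <= n%:R :> R by [].
have pack (L : R) (N : {set X}) u : 0 < L -> separated (eps / 32 * L) N ->
    #|[set v in N | mdist u v <= 8 * L]|%:R <= n%:R :> R.
  move=> L0 sep; rewrite ler_nat; apply: doubling_packing sep => //.
  by rewrite mulrAC ler_wpM2r // ltW.
have eta0 : 0 <= 4 * (eps / 32 * M%:R) / 2 ^+ m + 2 * (eps / 32).
  by rewrite addr_ge0 // ?divr_ge0 ?mulr_ge0 // ltW.
have cls (c : 'I_m) := class_spanner sT iT cT X0 sg0 M0 sgM
  e0 e1 q2 n0 pack J (mulr_gt0 l0 (exprn_gt0 c (ltr0n R 2)) : 0 < l * 2 ^+ c).
have [G HG] := choice cls.
have [N HN] := choice HG.
pose S : rel X := fun x y => [exists c, G c x y].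
have sS : symmetric S.
  by move=> a b; apply: eq_existsb => c; have [[-> _ _] _ _] := HN c.
have iS : irreflexive S.
  move=> a; apply/negbTE/existsPn => c; have [[_ iG _] _ _] := HN c; by rewrite iG.
exists S, (weight S / weight T); split; last 1 first.
- have := lightness_bound hd eps0 eps1 C1 (eq_rect_r (fun c => _ <= c / _) mle CE) Mle.
  rewrite -/n; set K := 16 * _ * _; apply: le_trans.
  have wS : weight S <= m%:R * ((1 + 3 * K) * weight T).
    apply: le_trans (weight_exists G) _.
    rewrite mulr_natl -[X in _ *+ X]card_ord -sumr_const; apply: ler_sum => c _.
    by have [_ _ H] := HN c; exact: H.
  have K1 : 0 <= 1 + 3 * K.
    rewrite addr_ge0 // mulr_ge0 // mulr_ge0 ?mulr_ge0 //.
    by apply: addr_ge0; apply: divr_ge0; rewrite ?mulr_ge0 // ltW.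
  (* When the minimum spanning tree has weight 0, as on a one-point space, division by 0 makes the
     lightness 0. *)
  have [w0|w0] := eqVneq (weight T) 0; first by rewrite w0 invr0 mulr0 mulr_ge0.
  have wT : 0 < weight T by rewrite lt_def w0 weight_ge0.
  by rewrite ler_pdivrMr // -mulrA.
- split => // x y; have [p [Sp lp wp]] : reach S x y ((1 + eps) * mdist x y).
    apply: (class_union_spanner (N := N) eps0 eps1 l0 m0 eta0 eta8 lmin lmax) => [c|c i iJ].
      by have [[]] := HN c.
    by have [_ H _] := HN c; have := H i iJ.
  apply: le_trans (ereal_inf_lbound _) _; first by exists p.
  by rewrite lee_fin.
- by exists T.
Qed.
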